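(* Let $X$, $Y$ be separable real Hilbert spaces and $A\colon X\to Y$ a bounded linear operator. Let $x$ be a square-integrable $X$-valued random variable with mean $\mu\in X$ and injective (trace-class) covariance operator $\Sigma_x\colon X\to X$. Let $\varepsilon$ be a zero-mean linear random process on $Y$ with bounded injective covariance $\Sigma_\varepsilon\colon Y\to Y$, independent of $x$. Let $K$ be a separable real Hilbert space and $\iota\colon K\to Y$ a bounded injective linear map with dense range such that $\iota^*\circ\Sigma_\varepsilon\circ\iota\colon K\to K^*$ is trace-class, and regard $\varepsilon$ as a $K^*$-valued random vector. Let $y=\iota^*Ax+\varepsilon$ and let $\rho$ be the joint distribution of $(x,y)$ on $X\times K^*$. Call a bounded positive operator $B\colon X\to X$ admissible if $\operatorname{Im}(AB)\subseteq\operatorname{Im}(\Sigma_\varepsilon\iota)$, and suppose that $\Sigma_x^{1/2}$ is admissible. For $h\in X$ and $B$ admissible let $$R_{h,B}(y)=h+B\,(BA^*\Sigma_\varepsilon^{-1}AB+I)^{-1}\big((\Sigma_\varepsilon\iota)^{-1}AB\big)^*(y-\iota^*Ah),\qquad y\in K^*.$$ Consider the minimization problem $$\min_{h,B}\ \mathbb{E}_{(x,y)\sim\rho}\big[\|R_{h,B}(y)-x\|_X^2\big],$$ over all $h\in X$ and all admissible $B$. Then $(h^\star,B^\star)$ (with $h^\star\in X$ and $B^\star$ admissible) is a global minimizer if and only if $$h^\star=\mu\qquad\text{and}\qquad (B^\star)^2|_{(\ker A)^\perp}=\Sigma_x|_{(\ker A)^\perp}.$$ In particular, $B^\star=\Sigma_x^{1/2}$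 (with $h^\star=\mu$) is always a global minimizer, and it is the unique one if $A$ is injective. Furthermore, for every minimizer $(h^\star,B^\star)$ the corresponding reconstruction map $R^\star=R_{h^\star,B^\star}$ is independent of $B^\star$ and, for all $y\in K^*$, is given by $$R^\star(y)=\mu+\Sigma_x^{1/2}\big(\Sigma_x^{1/2}A^*\Sigma_\varepsilon^{-1}A\Sigma_x^{1/2}+I_X\big)^{-1}\big((\Sigma_\varepsilon\iota)^{-1}A\Sigma_x^{1/2}\big)^*(y-\iota^*A\mu)$$ $$=\mu+\Sigma_xA^*\big(\iota^*(A\Sigma_xA^*+\Sigma_\varepsilon)\big)^{-1}(y-\iota^*A\mu),$$ where in the last expression $\Sigma_xA^*(\iota^*(A\Sigma_xA^*+\Sigma_\varepsilon))^{-1}$, a priori defined on the range of $\iota^*(A\Sigma_xA^*+\Sigma_\varepsilon)\colon Y\to K^*$, denotes its extension to a bounded operator $K^*\to X$.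
   Context: Conventions: $X$ and $Y$ are identified with their duals, but $K$ is not identified with $K^*$; thus $A^*\colon Y\to X$, $\iota^*\colon Y\to K^*$, and for bounded $T\colon X\to K$ the adjoint is $T^*\colon K^*\to X$, $\langle T^*u,v\rangle_X=\langle u,Tv\rangle_{K^*\times K}$. ''Positive'' means self-adjoint and non-negative; an operator $K\to K^*$ is trace-class if it is so after the Riesz identification of $K^*$ with $K$. A zero-mean linear random process on $Y$ with covariance $\Sigma_\varepsilon$ is a family $(\varepsilon_v)_{v\in Y}$ of real random variables on a common probability space, linear in $v$, with $\mathbb{E}[\varepsilon_v]=0$ and $\mathbb{E}[\varepsilon_v\varepsilon_w]=\langle\Sigma_\varepsilon v,w\rangle_Y$ for all $v,w\in Y$ (so $\Sigma_\varepsilon$ is self-adjoint and non-negative). Since $\iota^*\Sigma_\varepsilon\iota$ is trace-class, there is a unique square-integrable zero-mean $K^*$-valued random vector, still denoted $\varepsilon$, with $\langle\varepsilon,v\rangle_{K^*\times K}=\varepsilon_{\iota(v)}$ a.s. for each $v\in K$; its covariance is $\iota^*\Sigma_\varepsilon\iota$. The inverses $\Sigma_\varepsilon^{-1}\colon\operatorname{Im}\Sigma_\varepsilon\to Y$ and $(\Sigma_\varepsilon\iota)^{-1}\colon\operatorname{Im}(\Sigma_\varepsilon\iota)\to K$ are in general unbounded. For $B$ admissible, $(\Sigma_\varepsilon\iota)^{-1}AB\colon X\to K$ and $BA^*\Sigma_\varepsilon^{-1}AB\colon X\to X$ are everywhere defined and bounded. *)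

(* Defs.v *)
From HB Require Import structures.
From mathcomp Require Import all_boot all_order all_algebra.
From mathcomp Require Import all_classical all_reals all_analysis.

Set Implicit Arguments.
Unset Strict Implicit.
Unset Printing Implicit Defensive.

Import Order.TTheory GRing.Theory Num.Theory.
Import numFieldNormedType.Exports.

Local Open Scope classical_set_scope.
Local Open Scope ring_scope.

HB.mixin Record CompleteNormedModule_isHilbert (R : realType) H
    & CompleteNormedModule R H := {
  inner : {dot H for idfun};
  inner_norm : forall u : H, inner u u = `|u| ^+ 2
}.

#[short(type="hilbertType")]
HB.structure Definition Hilbert (R : realType) :=
  {H of CompleteNormedModule_isHilbert R H & CompleteNormedModule R H}.

Definition separable (T : topologicalType) : Prop :=
  exists D : set T, countable D /\ dense D.

Definition bounded_op (R : realType) (U V : normedModType R) (T : U -> V) :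
    Prop :=
  linear T /\ exists C : R, forall u, `|T u| <= C * `|u|.

Section dual_space.
Context (R : realType) (K : normedModType R).

Definition dual_pred : {pred K -> R^o} := mem [set f : K -> R^o | bounded_op f].

Lemma dual_submod_closed : submod_closed dual_pred.
Proof.
split.
  apply/mem_set; split; first by move=> a u v /=; rewrite scaler0 addr0.
  by exists 0 => u; rewrite mul0r normr0.
move=> a f g /set_mem[lf [C hC]] /set_mem[lg [D hD]]; apply/mem_set; split.
  move=> b u v; change (a *: f (b *: u + v) + g (b *: u + v) =
    b *: (a *: f u + g u) + (a *: f v + g v)).
  by rewrite lf lg !scalerDr !scalerA addrACA (mulrC a b).
exists (`|a| * C + D) => u; change (`|a *: f u + g u| <= (`|a| * C + D) * `|u|).
apply: le_trans (ler_normD _ _) _; rewrite normrZ mulrDl lerD//.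
by rewrite -mulrA ler_wpM2l.
Qed.

HB.instance Definition _ :=
  GRing.isSubmodClosed.Build R (K -> R^o) dual_pred dual_submod_closed.

Record dual := Dual {
  dual_fun :> K -> R^o;
  dualP : dual_fun \in dual_pred }.

HB.instance Definition _ := [isSub for dual_fun].
HB.instance Definition _ := [Choice of dual by <:].
HB.instance Definition _ := [SubChoice_isSubLmodule of dual by <:].

Lemma dualDE (f g : dual) u : (f + g) u = f u + g u.
Proof. by []. Qed.

Lemma dualZE (a : R) (f : dual) u : (a *: f) u = a * f u.
Proof. by []. Qed.

Lemma dual_bounded_op (f : dual) : bounded_op f.
Proof. exact: set_mem (dualP f). Qed.

Definition dual_norm (f : dual) : R :=
  sup [set `|f u| | u in [set u : K | `|u| <= 1]].

Let im (f : dual) := [set `|f u| | u in [set u : K | `|u| <= 1]].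

Let dual0 (f : dual) : f 0 = 0.
Proof.
have [lf _] := dual_bounded_op f.
by have := lf (-1) 0 0; rewrite !scaleN1r oppr0 addr0 addNr.
Qed.

Let dualZr (f : dual) a u : f (a *: u) = a * f u.
Proof.
have [lf _] := dual_bounded_op f.
by have := lf a u 0; rewrite addr0 dual0 addr0.
Qed.

Let im_sup (f : dual) : has_sup (im f).
Proof.
split; first by exists `|f 0|; exists 0 => //=; rewrite normr0 ler01.
have [_ [C hC]] := dual_bounded_op f; exists `|C| => _ [u u1 <-].
apply: le_trans (hC u) _; apply: le_trans (_ : `|C| * `|u| <= _).
  by rewrite ler_wpM2r// ler_norm.
by rewrite -[leRHS]mulr1 ler_wpM2l.
Qed.

Let le_dual_norm (f : dual) u : `|u| <= 1 -> `|f u| <= dual_norm f.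
Proof. by move=> u1; apply: (ub_le_sup (im_sup f).2); exists u. Qed.

Let dual_norm_le (f : dual) c :
  (forall u, `|u| <= 1 -> `|f u| <= c) -> dual_norm f <= c.
Proof.
by move=> h; apply: (ge_sup (im_sup f).1) => _ [u u1 <-]; exact: h.
Qed.

Let dual_normD f g : dual_norm (f + g) <= dual_norm f + dual_norm g.
Proof.
apply: dual_norm_le => u u1; rewrite dualDE.
by rewrite (le_trans (ler_normD _ _))// lerD// le_dual_norm.
Qed.

Let dual_norm_ge0 f : 0 <= dual_norm f.
Proof.
by apply: le_trans (le_dual_norm f (u := 0) _) => //; rewrite normr0 ler01.
Qed.

Let dual_normZ a f : dual_norm (a *: f) = `|a| * dual_norm f.
Proof.
have leZ b h : dual_norm (b *: h) <= `|b| * dual_norm h.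
  by apply: dual_norm_le => u u1; rewrite dualZE normrM ler_wpM2l// le_dual_norm.
apply/eqP; rewrite eq_le leZ/=.
have [->|a0] := eqVneq a 0; first by rewrite normr0 mul0r dual_norm_ge0.
have {1}-> : f = a^-1 *: (a *: f) by rewrite scalerA mulVf// scale1r.
rewrite -ler_pdivlMl ?normr_gt0//.
by rewrite -normfV leZ.
Qed.

Let dual_norm0_eq0 f : dual_norm f = 0 -> f = 0.
Proof.
move=> f0; apply: val_inj; apply/funext => u.
have [->|u0] := eqVneq u 0; first by rewrite /= dual0.
have nu0 : `|u| != 0 by rewrite normr_eq0.
have /(le_dual_norm f) : `| `|u|^-1 *: u| <= 1.
  by rewrite normrZ normfV normr_id mulVf.
rewrite f0 dualZr normr_le0 mulf_eq0 invr_eq0 (negbTE nu0)/= => /eqP ->.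
by [].
Qed.

HB.instance Definition _ := @Lmodule_isNormed.Build R dual dual_norm
  dual_normD dual_normZ dual_norm0_eq0.

End dual_space.

Section operators.
Context (R : realType).
Implicit Types H X Y K : hilbertType R.

(* The Riesz representative of [phi]; the junk value [0] is only reached when
   [phi] is not a bounded linear functional. *)
Definition riesz H (phi : H -> R) : H :=
  xget 0 [set w | forall v, inner w v = phi v].

Definition adjoint X Y (T : X -> Y) : Y -> X :=
  fun u => riesz (fun v => inner u (T v)).

(* The adjoint [T^* : K^* -> X] of [T : X -> K] when [K] is not identified with
   its dual. *)
Definition adjoint_from_dual X K (T : X -> K) : dual K -> X :=
  fun u => riesz (fun v => u (T v)).

(* The adjoint [T^* : Y -> K^*] of [T : K -> Y] when [K] is not identified with
   its dual; [insubd] falls back to [0] only when [T] is not a bounded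
   operator. *)
Definition adjoint_to_dual K Y (T : K -> Y) : Y -> dual K :=
  fun y => insubd (0 : dual K) (fun v => inner y (T v)).

(* The inverse [range T -> U] of an injective [T], extended by [0]. *)
Definition inv_op (U V : normedModType R) (T : U -> V) : V -> U :=
  'pinv_(fun=> 0) [set: U] T.

Definition orthocomp H (E : set H) : set H :=
  [set u | forall v, E v -> inner u v = 0].

Definition positive_op H (T : H -> H) : Prop :=
  [/\ bounded_op T,
      forall u v, inner (T u) v = inner u (T v) &
      forall u, 0 <= inner (T u) u].

Definition sqrt_op H (T : H -> H) : H -> H :=
  xget (fun=> 0) [set S | positive_op S /\ S \o S = T].

Definition hilbert_basis H (E : set H) : Prop :=
  (forall e f, E e -> E f -> inner e f = (e == f)%:R) /\
  orthocomp E = [set 0].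

(* [T] is trace-class when [|T| = (T^* T)^(1/2)] has a finite trace. *)
Definition trace_class H (T : H -> H) : Prop :=
  bounded_op T /\
  exists2 E : set H, hilbert_basis E &
    (\esum_(e in E) (inner (sqrt_op (adjoint T \o T) e) e)%:E < +oo)%E.

Definition trace_class_to_dual K (T : K -> dual K) : Prop :=
  trace_class (fun v => riesz (T v)).

End operators.

(* [V] with the Borel sigma-algebra of its norm topology. *)
Notation borel V := (g_sigma_algebraType (@open V)).

Section probability.
Context (R : realType) (d : measure_display) (T : measurableType d)
  (P : probability T R).
Local Open Scope ereal_scope.

Definition square_integrable (V : normedModType R) (x : T -> V) : Prop :=
  'E_P[fun t => (`|x t| ^+ 2)%R] < +oo.

(* The mean is characterised weakly; for square-integrable [x] it is the Bochner
   integral. *)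
Definition is_mean (X : hilbertType R) (x : T -> X) (mu : X) : Prop :=
  forall v, 'E_P[fun t => inner (x t) v] = (inner mu v)%:E.

Definition is_covariance (X : hilbertType R) (x : T -> X) (mu : X)
    (S : X -> X) : Prop :=
  forall u v, 'E_P[fun t => (inner (x t - mu) u * inner (x t - mu) v)%R] =
    (inner (S u) v)%:E.

(* Linearity in [v] is an equality of random variables, hence almost sure; the
   exceptional set may depend on [a], [v] and [w]. *)
Definition zero_mean_linear_process (Y : hilbertType R)
    (noise : Y -> {RV P >-> R}) (S : Y -> Y) : Prop :=
  [/\ forall (a : R) v w,
        {ae P, forall t, noise (a *: v + w)%R t = (a * noise v t + noise w t)%R},
      forall v, 'E_P[noise v] = 0 &
      forall v w, 'E_P[fun t => (noise v t * noise w t)%R] =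
        (inner (S v) w)%:E].

Definition noise_vector (Y K : hilbertType R) (iota : K -> Y)
    (noise : Y -> {RV P >-> R}) (eps : T -> dual K) : Prop :=
  [/\ square_integrable eps,
      forall v, 'E_P[fun t => eps t v] = 0 &
      forall v, {ae P, forall t, eps t v = noise (iota v) t}].

Definition independent_sigma (F G : set (set T)) : Prop :=
  forall A B, F A -> G B -> P (A `&` B) = P A * P B.

Definition sigma_rv (d' : measure_display) (T' : measurableType d')
    (x : T -> T') : set (set T) :=
  preimage_set_system [set: T] x measurable.

Definition sigma_process (I : Type) (noise : I -> {RV P >-> R}) :
    set (set T) :=
  <<s \bigcup_(i in [set: I]) sigma_rv (noise i) >>.

End probability.

Section reconstruction.
Context (R : realType) (X Y K : hilbertType R).
Variables (A : X -> Y) (Seps : Y -> Y) (iota : K -> Y).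

Definition admissible (B : X -> X) : Prop :=
  positive_op B /\ range (A \o B) `<=` range (Seps \o iota).

Definition recon (h : X) (B : X -> X) (y : dual K) : X :=
  h + B (inv_op (fun u => B (adjoint A (inv_op Seps (A (B u)))) + u)
    (adjoint_from_dual (inv_op (Seps \o iota) \o A \o B)
      (y - adjoint_to_dual iota (A h)))).

Definition risk (rho : set (borel X * borel (dual K)) -> \bar R)
    (h : X) (B : X -> X) : \bar R :=
  (\int[rho]_z (`|recon h B z.2 - z.1| ^+ 2)%:E)%E.

Definition is_minimizer (rho : set (borel X * borel (dual K)) -> \bar R)
    (h : X) (B : X -> X) : Prop :=
  admissible B /\
  forall h' B', admissible B' -> (risk rho h B <= risk rho h' B')%E.

Definition data_cov (Sx : X -> X) : Y -> dual K :=
  adjoint_to_dual iota \o (fun w => A (Sx (adjoint A w)) + Seps w).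

(* [L] is a bounded extension to all of [K^*] of
   [Sx A^* (iota^* (A Sx A^* + Seps))^-1]. *)
Definition bounded_extension (Sx : X -> X) (L : dual K -> X) : Prop :=
  bounded_op L /\
  forall z, range (data_cov Sx) z ->
    L z = Sx (adjoint A (inv_op (data_cov Sx) z)).

End reconstruction.

(* Main.v *)
(** The [e]-component of the reconstruction is an affine functional of the data,
    determined by [k_e = C (G + I)^-1 B e] in [K], where [C = (Seps iota)^-1 A B]
    and [G = C^* (iota^* Seps iota) C].  By independence its mean squared error is
    [<Sx a, a> + <Seps iota k_e, iota k_e> + <mu - h, a>^2] with
    [a = A^* iota k_e - e], and the risk is the sum of these terms over an
    orthonormal basis.  Since [k_e] solves
    [(A B^2 A^* + Seps) iota k_e = A B^2 e], the choice [B^2 = Sx] solves the normal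
    equation of the quadratic part for every [e] at once, so completing the square
    expresses the excess risk as a sum of nonnegative terms.  It vanishes exactly
    when [h = mu] and [k_e] is the optimal coefficient for all [e], which in turn
    means [A B^2 = A Sx]. *)
Require Import Defs.
From HB Require Import structures.
From mathcomp Require Import all_boot all_order all_algebra ring lra.
From mathcomp Require Import all_classical all_reals all_analysis.
From mathcomp Require Import measurable_realfun.

Set Implicit Arguments.
Unset Strict Implicit.
Unset Printing Implicit Defensive.

Import Order.TTheory GRing.Theory Num.Theory.
Import numFieldNormedType.Exports.

Local Open Scope classical_set_scope.
Local Open Scope ring_scope.

(** * Inner products and bounded operators *)


(** The inverses of [Seps] and [Seps \o iota] are unbounded, so they are kept out of the estimates.
    Admissibility gives a bounded [C] through the closed graph theorem, [Seps^-1 A B] becomes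
    [iota \o C], and each later operator identity is tested against a vector [e], which leaves
    scalar equations in [k_e]. The noise forces the same form: [eps] agrees with the process only
    almost surely, for one test vector at a time. Completing the square is not enough at two points.
    Risks are extended reals, so the optimal one must be finite before it can be cancelled;
    comparison with the zero coefficient bounds it by the expectation of [|x - mu|^2]. And both
    [h = mu] and [A B^2 = A Sx] are extracted from a vanishing excess by the injectivity of
    [I - W iota^* A], where [W] is the linear part of the reconstruction. Riesz representatives,
    adjoints and square roots are defined by choice with a default value, hence the existence proofs
    that come before any probability. *)

Section inner_product.
Context (R : realType) (H : hilbertType R).
Implicit Types u v w : H.

Lemma innerC u v : inner u v = inner v u.
Proof. by rewrite hermC /= expr0 mul1r. Qed.

Lemma innerDl u v w : inner (u + v) w = inner u w + inner v w.
Proof. by rewrite linearDl. Qed.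

Lemma innerDr u v w : inner w (u + v) = inner w u + inner w v.
Proof. by rewrite linearDr. Qed.

Lemma innerZl a u v : inner (a *: u) v = a * inner u v.
Proof. by rewrite linearZl_LR. Qed.

Lemma innerZr a u v : inner v (a *: u) = a * inner v u.
Proof. by rewrite linearZr_LR. Qed.

Lemma inner0l v : inner 0 v = 0. Proof. by rewrite linear0l. Qed.

Lemma inner0r v : inner v 0 = 0. Proof. by rewrite linear0r. Qed.

Lemma innerNl u v : inner (- u) v = - inner u v.
Proof. by rewrite linearNl. Qed.

Lemma innerNr u v : inner v (- u) = - inner v u.
Proof. by rewrite linearNr. Qed.

Lemma innerBl u v w : inner (u - v) w = inner u w - inner v w.
Proof. by rewrite linearBl. Qed.

Lemma innerBr u v w : inner w (u - v) = inner w u - inner w v.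
Proof. by rewrite linearBr. Qed.

Lemma sqr_norm u : `|u| ^+ 2 = inner u u.
Proof. by rewrite inner_norm. Qed.

Lemma inner_ge0 u : 0 <= inner u u.
Proof. by rewrite inner_norm sqr_ge0. Qed.

Lemma sqr_normD u v :
  `|u + v| ^+ 2 = `|u| ^+ 2 + 2 * inner u v + `|v| ^+ 2.
Proof. by rewrite !sqr_norm innerDl !innerDr (innerC v u); ring. Qed.

Lemma inner_eq0 u : inner u u = 0 -> u = 0.
Proof.
by rewrite inner_norm => /eqP; rewrite sqrf_eq0 normr_eq0 => /eqP.
Qed.

Lemma inner_ext u v : (forall w, inner u w = inner v w) -> u = v.
Proof.
move=> uv; apply/eqP; rewrite -subr_eq0; apply/eqP/inner_eq0.
by rewrite innerBl uv subrr.
Qed.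

Lemma sqr_discriminant (a b c : R) :
  (forall t, 0 <= a + 2 * t * b + t ^+ 2 * c) -> b ^+ 2 <= a * c.
Proof.
move=> h; have [c0|c0] := eqVneq c 0.
  have [->|b0] := eqVneq b 0; first by rewrite c0 expr0n/= mulr0.
  (* For [c = 0] the polynomial is affine; this is the point where it takes the value -1. *)
  have := h (- (a + 1) / (2 * b)); rewrite c0.
  have -> : a + 2 * (- (a + 1) / (2 * b)) * b +
    (- (a + 1) / (2 * b)) ^+ 2 * 0 = -1 by field.
  by lra.
have cp : 0 < c.
  rewrite lt_neqAle eq_sym c0 /= leNgt; apply/negP => cn.
  (* For [c < 0] the polynomial is negative far out. With [s] the quotient, [s * c] cancels
     [|a| + 1 + 2 |b|] exactly, and the extra 1 gives strictness. *)
  have := h ((`|a| + 1 + 2 * `|b|) / - c + 1).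
  have : 0 <= `|a| + 1 + 2 * `|b| by rewrite !addr_ge0// mulr_ge0.
  have : a <= `|a| by rewrite ler_norm.
  have : b <= `|b| by rewrite ler_norm.
  have : 0 <= `|b| by [].
  set B := `|b|; set A := `|a|.
  have cn' : 0 < - c by rewrite oppr_gt0.
  set s := (_ / - c) => B0 bB aA AB.
  have s0 : 0 <= s by rewrite divr_ge0// ltW.
  have sc : s * c = - (A + 1 + 2 * B) by rewrite /s; field.
  have -> : (s + 1) ^+ 2 * c = (s + 1) * (s * c) + (s + 1) * c by ring.
  have h1 : (s + 1) * c < 0 by rewrite pmulr_rlt0// ltr_wpDl.
  have h2 : s * b <= s * B by rewrite ler_wpM2l.
  have h3 : 0 <= s * A by rewrite mulr_ge0// /A.
  rewrite sc; lra.
have := h (- b / c).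
have -> : a + 2 * (- b / c) * b + (- b / c) ^+ 2 * c = (a * c - b ^+ 2) / c.
  by field.
by rewrite pmulr_lge0 ?invr_gt0// subr_ge0.
Qed.

(** Discriminant of [t |-> <T (t v + u), t v + u>]. The form may be degenerate: this is what turns
    [<T u, u> = 0] into [T u = 0], and [T = id] gives the usual inequality. *)
Lemma positive_CauchySchwarz (T : H -> H) u v : linear T ->
  (forall u v, inner (T u) v = inner u (T v)) ->
  (forall u, 0 <= inner (T u) u) ->
  inner (T u) v ^+ 2 <= inner (T u) u * inner (T v) v.
Proof.
move=> lT sT pT; apply: sqr_discriminant => t.
have := pT (t *: v + u); rewrite lT.
rewrite !innerDl !innerDr !innerZl !innerZr.
rewrite (sT v u) (innerC v).
by congr (_ <= _); ring.
Qed.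

Lemma positive_form_eq0 (T : H -> H) u : linear T ->
  (forall u v, inner (T u) v = inner u (T v)) ->
  (forall u, 0 <= inner (T u) u) ->
  inner (T u) u = 0 -> T u = 0.
Proof.
move=> lT sT pT Tu0; apply: inner_ext => v; rewrite inner0l.
have := positive_CauchySchwarz u v lT sT pT; rewrite Tu0 mul0r => h.
by apply/eqP; rewrite -sqrf_eq0 eq_le h sqr_ge0.
Qed.

Lemma inner_CauchySchwarz u v : `|inner u v| <= `|u| * `|v|.
Proof.
rewrite -(@ler_pXn2r _ 2)// ?nnegrE ?mulr_ge0// exprMn !sqr_norm.
rewrite real_normK ?num_real//.
apply: (@positive_CauchySchwarz idfun) => // w.
exact: inner_ge0.
Qed.

Lemma le_norm_inner u c : 0 <= c ->
  (forall v, `|inner u v| <= c * `|v|) -> `|u| <= c.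
Proof.
move=> c0 /(_ u); rewrite ger0_norm ?inner_ge0// inner_norm.
have [->|u0] := eqVneq u 0; first by rewrite normr0.
by rewrite expr2 ler_pM2r// normr_gt0.
Qed.

Lemma inner_cvg (u v : nat -> H) a b : u @ \oo --> a -> v @ \oo --> b ->
  inner (u n) (v n) @[n --> \oo] --> inner a b.
Proof.
have P (x y : H) : inner x y = 2^-1 * (`|x + y| ^+ 2 - `|x| ^+ 2 - `|y| ^+ 2).
  by rewrite !sqr_norm innerDl !innerDr (innerC y x); field.
move=> ua vb; rewrite P.
rewrite (_ : (fun n => _) = (fun n =>
   2^-1 * (`|u n + v n| ^+ 2 - `|u n| ^+ 2 - `|v n| ^+ 2))); last first.
  by apply/funext => n; exact: P.
apply: cvgMr; rewrite !expr2; apply: cvgB; [apply: cvgB|];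
  by apply: cvgM; apply: cvg_norm => //; apply: cvgD.
Qed.

Lemma innerl_cvg (u : nat -> H) a b : u @ \oo --> a ->
  inner (u n) b @[n --> \oo] --> inner a b.
Proof. by move=> ua; apply: inner_cvg => //; exact: cvg_cst. Qed.

End inner_product.
Arguments innerC {R H}.

Section sequences.
Context (R : realType) (V : completeNormedModType R).

Lemma cauchy_seq_cvg (u : nat -> V) :
  (forall e : R, 0 < e -> exists N, forall m n, (N <= m)%N -> (N <= n)%N ->
     `|u m - u n| < e) ->
  exists l : V, u @ \oo --> l.
Proof.
move=> h; exists (lim (u @ \oo)); apply: cauchy_cvg; apply/cauchyP => e e0.
have [N hN] := h e e0; exists (u N); exists N => // n /= Nn.
by rewrite -ball_normE /=; exact: hN.
Qed.

End sequences.

Section bounded_operators.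
Context (R : realType).
Implicit Types U V W : normedModType R.

Lemma boundedD U V (T : U -> V) : bounded_op T -> {morph T : u v / u + v}.
Proof. by move=> [lT _] u v; have := lT 1 u v; rewrite !scale1r. Qed.

Lemma bounded0 U V (T : U -> V) : bounded_op T -> T 0 = 0.
Proof.
by move=> [lT _]; have := lT (-1) 0 0; rewrite !scaleN1r oppr0 addr0 addNr.
Qed.

Lemma boundedZ U V (T : U -> V) : bounded_op T ->
  forall a u, T (a *: u) = a *: T u.
Proof.
by move=> bT a u; have := bT.1 a u 0; rewrite (bounded0 bT) !addr0.
Qed.

Lemma boundedN U V (T : U -> V) : bounded_op T -> {morph T : u / - u}.
Proof. by move=> bT u; rewrite -scaleN1r (boundedZ bT) scaleN1r. Qed.

Lemma boundedB U V (T : U -> V) : bounded_op T -> {morph T : u v / u - v}.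
Proof. by move=> bT u v; rewrite (boundedD bT) (boundedN bT). Qed.

Lemma bounded_op_gt0 U V (T : U -> V) : bounded_op T ->
  exists2 C : R, 0 < C & forall u, `|T u| <= C * `|u|.
Proof.
move=> [_ [C hC]]; exists (`|C| + 1); first by rewrite ltr_wpDl.
move=> u; apply: le_trans (hC u) _; rewrite ler_wpM2r//.
by rewrite (le_trans (ler_norm _))// lerDl.
Qed.

Lemma bounded_comp U V W (S : V -> W) (T : U -> V) :
  bounded_op S -> bounded_op T -> bounded_op (S \o T).
Proof.
move=> bS bT; split; first by move=> a u v /=; rewrite bT.1 bS.1.
have [C C0 hC] := bounded_op_gt0 bS; have [D D0 hD] := bounded_op_gt0 bT.
exists (C * D) => u /=; apply: le_trans (hC _) _.
by rewrite -mulrA ler_pM2l.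
Qed.

Lemma bounded_add U V (S T : U -> V) :
  bounded_op S -> bounded_op T -> bounded_op (fun u => S u + T u).
Proof.
move=> bS bT; split.
  by move=> a u v /=; rewrite bT.1 bS.1 scalerDr addrACA.
have [C C0 hC] := bounded_op_gt0 bS; have [D D0 hD] := bounded_op_gt0 bT.
exists (C + D) => u /=; apply: le_trans (ler_normD _ _) _.
by rewrite mulrDl lerD.
Qed.

Lemma bounded_scale U V (T : U -> V) (a : R) :
  bounded_op T -> bounded_op (fun u => a *: T u).
Proof.
move=> bT; split.
  by move=> b u v /=; rewrite bT.1 scalerDr !scalerA mulrC.
have [C C0 hC] := bounded_op_gt0 bT.
by exists (`|a| * C) => u /=; rewrite normrZ -mulrA ler_wpM2l.
Qed.

Lemma bounded_id U : bounded_op (@id U).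
Proof. by split=> //; exists 1 => u; rewrite mul1r. Qed.

Lemma bounded_cvg U V (T : U -> V) (u : nat -> U) l : bounded_op T ->
  u @ \oo --> l -> T (u n) @[n --> \oo] --> T l.
Proof.
move=> bT ul; have [C C0 hC] := bounded_op_gt0 bT.
apply/cvgrPdist_lt => e e0.
have /cvgrPdist_lt/(_ (e / C)) := ul.
rewrite divr_gt0// => /(_ erefl); apply: filterS => n h.
rewrite -(boundedB bT); apply: le_lt_trans (hC _) _.
by rewrite -ltr_pdivlMl// mulrC.
Qed.

End bounded_operators.

(** * Variational problems, adjoints and the closed graph theorem *)


Section variational.
Context (R : realType) (H : hilbertType R).

(* A minimising sequence of [v |-> <v + G v, v> - 2 f v] on [M] is Cauchy by the
   parallelogram law, and its limit satisfies the Euler equation. *)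
Lemma lax_milgram_subspace (M : set H) (G : H -> H) (f : H -> R) :
  M 0 -> (forall a u v, M u -> M v -> M (a *: u + v)) ->
  positive_op G ->
  (forall a u v, f (a *: u + v) = a * f u + f v) ->
  (exists C : R, forall u, `|f u| <= C * `|u|) ->
  exists v : nat -> H, exists w : H,
    [/\ forall n, M (v n), v @ \oo --> w &
        forall u, M u -> inner (w + G w) u = f u].
Proof.
move=> M0 Mlin [bG sG pG] lf [C hC].
pose a u v := inner (u + G u) v.
have aC u v : a u v = a v u by rewrite /a !innerDl sG (innerC u v) (innerC u (G v)).
have alin t u v w : a (t *: u + v) w = t * a u w + a v w.
  by rewrite /a bG.1 addrACA -scalerDr [LHS]innerDl innerZl.
have alinr t u v w : a w (t *: u + v) = t * a w u + a w v.
  by rewrite aC alin !(aC _ w).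
have a_ge u : `|u| ^+ 2 <= a u u.
  by rewrite /a innerDl -sqr_norm lerDl.
pose J v := a v v - 2 * f v.
have J_ge u : - C ^+ 2 <= J u.
  have := a_ge u; have := hC u; have := ler_norm (f u).
  rewrite /J; move: (a u u) (f u) (`|f u|) (`|u|) => s p q r.
  by have := sqr_ge0 (r - C); lra.
have infJ : has_inf (J @` M).
  split; first by exists (J 0), 0.
  by exists (- C ^+ 2) => _ [u _ <-].
pose m := inf (J @` M).
have Jm u : M u -> m <= J u.
  by move=> Mu; apply: (ge_inf infJ.2); exists u.
have /choice[v hv] n : exists u, M u /\ J u < m + n.+1%:R^-1.
  have [|_ [u Mu <-] Ju] := @inf_adherent _ (J @` M) n.+1%:R^-1 _ infJ.
    by rewrite invr_gt0.
  by exists u.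
have par u w : M u -> M w -> `|u - w| ^+ 2 <= 2 * (J u + J w - 2 * m).
  move=> Mu Mw; apply: le_trans (a_ge _) _.
  (* The midpoint of [u] and [w], written in the shape that the closure hypothesis on [M]
     accepts. *)
  have := Jm (2^-1 *: (1 *: u + w) + 0) (Mlin _ _ _ (Mlin _ _ _ Mu Mw) M0).
  have a0 z : a 0 z = 0 by have := alin (-1) 0 0 z; rewrite scaler0 addr0; lra.
  have a0r z : a z 0 = 0 by rewrite aC.
  have f0 : f 0 = 0 by have := lf (-1) 0 0; rewrite scaler0 addr0; lra.
  have -> : u - w = (-1) *: w + u by rewrite scaleN1r addrC.
  rewrite /J !(alin, alinr, lf, a0, a0r, f0) (aC w u); lra.
have [w vw] : exists w : H, v @ \oo --> w.
  apply: cauchy_seq_cvg => e e0.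
  have /cvgrPdist_lt/(_ (e ^+ 2 / 4)) := @cvg_harmonic R.
  rewrite divr_gt0 ?exprn_gt0// => /(_ erefl)[N _ hN]; exists N => p q Np Nq.
  rewrite -(@ltr_pXn2r _ 2) ?nnegrE ?(ltW e0)//.
  apply: le_lt_trans (par _ _ (hv p).1 (hv q).1) _.
  have := hN p Np; have := hN q Nq; rewrite /= !sub0r !normrN.
  rewrite !ger0_norm ?invr_ge0//.
  have := (hv p).2; have := (hv q).2.
  move: (J (v p)) (J (v q)) (p.+1%:R^-1) (q.+1%:R^-1) (m) (e ^+ 2).
  by move=> ? ? ? ? ? ? ? ? ? ?; lra.
exists v, w; split=> [n||u Mu]; [exact: (hv n).1|exact: vw|].
apply/eqP; rewrite -subr_eq0 -sqrf_eq0 eq_le sqr_ge0 andbT.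
(* [M] is not assumed closed, so [w] may lie outside it and the variation is taken at [v n].
   Near-minimality costs [1 / (n + 1)], which vanishes in the limit; a nonnegative quadratic with
   zero constant term has zero linear term. *)
rewrite -[leRHS](mul0r (a u u)); apply: sqr_discriminant => t.
have cvl : (n.+1%:R^-1 + 2 * t * (a (v n) u - f u) + t ^+ 2 * a u u : R)
    @[n --> \oo] --> 0 + 2 * t * (a w u - f u) + t ^+ 2 * a u u.
  apply: cvgD; last exact: cvg_cst.
  apply: cvgD; first exact: cvg_harmonic.
  apply: cvgMr; apply: cvgB; last exact: cvg_cst.
  apply: innerl_cvg; apply: cvgD => //; exact: bounded_cvg vw.
rewrite -(cvg_lim _ cvl)//; apply: limr_ge; first by apply/cvg_ex; eexists; exact: cvl.
apply: nearW => n.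
have := Jm (t *: u + v n) (Mlin _ _ _ Mu (hv n).1); have := (hv n).2.
rewrite /J !(alin, alinr, lf) (aC u (v n)).
by move: (n.+1%:R^-1) (m) => ? ? ? ?; lra.
Qed.

Lemma positive_op0 : positive_op (fun _ : H => 0).
Proof.
split; last by move=> u; rewrite inner0l.
- split; first by move=> a u v; rewrite scaler0 addr0.
  by exists 0 => u; rewrite normr0 mul0r.
- by move=> u v; rewrite inner0l inner0r.
Qed.

(** The variational lemma with [G = 0] on the whole space produces a representative, so the choice
    in [riesz] does not fall back to its default. *)
Lemma rieszP (f : H -> R) :
  (forall a u v, f (a *: u + v) = a * f u + f v) ->
  (exists C : R, forall u, `|f u| <= C * `|u|) ->
  forall v, inner (riesz f) v = f v.
Proof.
move=> lf bf; rewrite /riesz; case: xgetP => [w _ //|] no.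
have [_ [w [_ _ hw]]] := @lax_milgram_subspace setT _ f Logic.I
  (fun _ _ _ _ _ => Logic.I) positive_op0 lf bf.
by case: (no w) => v /=; rewrite -hw// addr0.
Qed.

(** For [G = 0] and [f = <u, .>] the minimising sequence lies in [M] and tends to the projection of
    [u] on the closure of [M]; the residual is orthogonal to [M], hence zero. *)
Lemma dense_subspaceP (M : set H) :
  M 0 -> (forall a u v, M u -> M v -> M (a *: u + v)) ->
  orthocomp M `<=` [set 0] ->
  forall u : H, exists v : nat -> H, (forall n, M (v n)) /\ v @ \oo --> u.
Proof.
move=> M0 Mlin Mo u.
have [||v [w [Mv vw hw]]] :=
    @lax_milgram_subspace M _ (inner u) M0 Mlin positive_op0.
- by move=> a x y; rewrite innerDr innerZr.
- by exists `|u| => x; exact: inner_CauchySchwarz.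
exists v; split=> //; suff -> : u = w by [].
apply/eqP; rewrite -subr_eq0; apply/eqP; apply: Mo => x Mx.
by rewrite innerBl -(hw x Mx) addr0 subrr.
Qed.

End variational.

Section adjoints.
Context (R : realType).
Implicit Types X Y K : hilbertType R.

Lemma adjointP X Y (T : X -> Y) : bounded_op T ->
  forall u v, inner (adjoint T u) v = inner u (T v).
Proof.
move=> bT u; apply: rieszP => [a x y|]; first by rewrite bT.1 innerDr innerZr.
have [C C0 hC] := bounded_op_gt0 bT; exists (`|u| * C) => v.
apply: le_trans (inner_CauchySchwarz _ _) _.
by rewrite -mulrA ler_wpM2l.
Qed.

Lemma adjoint_bounded X Y (T : X -> Y) : bounded_op T -> bounded_op (adjoint T).
Proof.
move=> bT; split.
  move=> a u v; apply: inner_ext => w.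
  by rewrite adjointP// !innerDl !innerZl !adjointP.
have [C C0 hC] := bounded_op_gt0 bT; exists C => u.
apply: le_norm_inner => [|v]; first by rewrite mulr_ge0// ltW.
rewrite adjointP//; apply: le_trans (inner_CauchySchwarz _ _) _.
by rewrite (mulrC C) -mulrA ler_wpM2l.
Qed.

Lemma injective_adjoint_dense X Y (T : X -> Y) : bounded_op T -> injective T ->
  forall u : X, exists y : nat -> Y, adjoint T (y n) @[n --> \oo] --> u.
Proof.
move=> bT iT u.
have bT' := adjoint_bounded bT.
have [|a _ _ [x _ <-] [y _ <-]||v [hv vu]] :=
    @dense_subspaceP _ _ (range (adjoint T)) _ _ _ u.
- by exists 0 => //; exact: bounded0.
- by exists (a *: x + y) => //; rewrite bT'.1.
- move=> x hx; apply: iT; rewrite (bounded0 bT); apply: inner_ext => y.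
  by rewrite inner0l innerC -adjointP// innerC; apply: hx; exists y.
have /choice[y hy] n : exists y, adjoint T y = v n by have [y _ <-] := hv n; exists y.
by exists y; under eq_fun do rewrite hy.
Qed.

(* Closed graph theorem in the factorised form: [T C = S] with [S], [T] bounded
   and [T] injective.  Banach-Steinhaus applies to the functionals [<S^* y, .>]
   with [|T^* y| <= 1], since [<S^* y, v> = <T^* y, C v>]. *)
Lemma bounded_factor X Y K (S : X -> Y) (T : K -> Y) (C : X -> K) :
  bounded_op S -> bounded_op T -> injective T -> (forall u, T (C u) = S u) ->
  bounded_op C.
Proof.
move=> bS bT iT TC; split.
  by move=> a u v; apply: iT; rewrite TC bT.1 !TC bS.1.
pose F : set (X -> R) :=
  [set f | exists2 y, `|adjoint T y| <= 1 & f = inner (adjoint S y)].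
have SC y v : inner (adjoint S y) v = inner (adjoint T y) (C v).
  by rewrite !adjointP// TC.
have [|x|M hM] := @Banach_Steinhauss R X R^o F _ _ 1.
- move=> _ [y _ ->]; split.
    move=> r; exists (`|adjoint S y| * `|r|) => x xr.
    apply: le_trans (inner_CauchySchwarz _ _) _; rewrite ler_wpM2l//.
    exact: le_trans (ler_norm _).
  by move=> a u v; rewrite innerDr innerZr.
- exists `|C x| => _ [y y1 ->]; rewrite SC; apply: le_trans (inner_CauchySchwarz _ _) _.
  by rewrite ler_piMl.
have M0 : 0 <= M.
  apply: le_trans (hM (inner (adjoint S 0)) _ 0 _) => //; last by rewrite normr0.
  by exists 0 => //; rewrite (bounded0 (adjoint_bounded bT)) normr0.
have key y v : `|inner (adjoint T y) (C v)| <= M * `|v| * `|adjoint T y|.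
  have [v0|v0] := eqVneq v 0.
    by rewrite -SC v0 inner0r !normr0 mulr0 mul0r.
  have [y0|y0] := eqVneq (adjoint T y) 0.
    by rewrite y0 inner0l !normr0 mulr0.
  have np : 0 < `|v| by rewrite normr_gt0.
  have yp : 0 < `|adjoint T y| by rewrite normr_gt0.
  have := hM (inner (adjoint S (`|adjoint T y|^-1 *: y))) _ (`|v|^-1 *: v).
  rewrite normrZ normfV normr_id mulVf ?gt_eqF// lexx => h.
  have := h _ isT; rewrite innerZr (boundedZ (adjoint_bounded bS)) innerZl SC.
  rewrite !normrM !normfV !normr_id => h'.
  rewrite mulrAC -ler_pdivrMr// -ler_pdivrMr//.
  rewrite [leLHS](_ : _ = `|v|^-1 * (`|adjoint T y|^-1 *
     `|inner (adjoint T y) (C v)|)); last by field; rewrite !gt_eqF.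
  apply: h'; exists (`|adjoint T y|^-1 *: y); last first.
    by rewrite (boundedZ (adjoint_bounded bS)).
  rewrite (boundedZ (adjoint_bounded bT)) normrZ normfV normr_id mulVf//.
  by rewrite gt_eqF.
(* Injectivity of [T] makes the range of its adjoint dense in [K], so the bound [key] passes to
   every [k] in the limit. *)
exists M => v; apply: le_norm_inner => [|k]; first by rewrite mulr_ge0.
have [y yk] := injective_adjoint_dense bT iT k.
have c1 : `|inner (adjoint T (y n)) (C v)| @[n --> \oo] --> `|inner k (C v)|.
  by apply: cvg_norm; exact: innerl_cvg.
have c2 : M * `|v| * `|adjoint T (y n)| @[n --> \oo] --> M * `|v| * `|k|.
  by apply: cvgMr; exact: cvg_norm.
rewrite innerC; apply: (ler_cvg_to c1 c2); apply: nearW => n; exact: key.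
Qed.

Lemma positive_add_id_inj X (G : X -> X) : positive_op G ->
  forall u v, G u + u = G v + v -> u = v.
Proof.
move=> [bG sG pG] u v e; apply/eqP; rewrite -subr_eq0; apply/eqP/inner_eq0.
have : inner (G (u - v) + (u - v)) (u - v) = 0.
  by rewrite (boundedB bG) addrACA e -opprD subrr inner0l.
rewrite innerDl => e0; have := pG (u - v); have := inner_ge0 (u - v); lra.
Qed.

Lemma positive_add_id_surj X (G : X -> X) : positive_op G ->
  forall r, exists u, G u + u = r.
Proof.
move=> pG r; have [||_ [w [_ _ hw]]] := @lax_milgram_subspace _ X setT G (inner r) Logic.I
    (fun _ _ _ _ _ => Logic.I) pG.
- by move=> a u v; rewrite innerDr innerZr.
- by exists `|r| => v; exact: inner_CauchySchwarz.
by exists w; apply: inner_ext => v; rewrite addrC hw.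
Qed.

End adjoints.

(** * Positive square roots *)


Section square_root.
Context (R : realType) (H : hilbertType R).

Section contraction.
Variable Z : H -> H.
Hypothesis bZ : bounded_op Z.
Hypothesis sZ : forall u v, inner (Z u) v = inner u (Z v).
Hypothesis Z1 : forall u, `|Z u| <= `|u|.

(** Fixed-point iteration for [L = (Z + L^2) / 2], an equation equivalent to [(I - L)^2 = I - Z]. *)
Let Y (n : nat) : H -> H :=
  iter n (fun S u => 2^-1 *: (Z u + S (S u))) (fun=> 0).

(** Scalar majorant: the same recursion with [Z] replaced by its norm bound 1. It increases and
    stays below 1, so it converges, and its increments control those of [Y]. *)
Let y (n : nat) : R := iter n (fun t => 2^-1 * (1 + t ^+ 2)) 0.

Let YS n u : Y n.+1 u = 2^-1 *: (Z u + Y n (Y n u)). Proof. by []. Qed.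

Let yS n : y n.+1 = 2^-1 * (1 + y n ^+ 2). Proof. by []. Qed.

Let bY n : bounded_op (Y n).
Proof.
elim: n => [|n IH]; first by case: (positive_op0 H).
exact: bounded_scale (bounded_add bZ (bounded_comp IH IH)).
Qed.

Let sY n u v : inner (Y n u) v = inner u (Y n v).
Proof.
elim: n u v => [|n IH] u v; first by rewrite /= inner0l inner0r.
by rewrite !YS innerZl innerZr innerDl innerDr sZ !IH.
Qed.

Let y_bound n : 0 <= y n <= 1.
Proof.
elim: n => [|n /andP[a b]]; first by rewrite /y /= lexx ler01.
by rewrite yS; apply/andP; split; nra.
Qed.

Let y_le n : y n <= y n.+1.
Proof. by have := sqr_ge0 (1 - y n); rewrite yS; lra. Qed.

Let Y_comm (D : H -> H) : bounded_op D -> (forall u, D (Z u) = Z (D u)) ->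
  forall n u, D (Y n u) = Y n (D u).
Proof.
move=> bD DZ; elim=> [|n IH] u; first by rewrite /= (bounded0 bD).
by rewrite !YS (boundedZ bD) (boundedD bD) DZ !IH.
Qed.

Let YY_comm n m u : Y n (Y m u) = Y m (Y n u).
Proof.
apply: Y_comm; first exact: bY.
by move=> v; rewrite -(Y_comm bZ).
Qed.

Let Y_le n u : `|Y n u| <= y n * `|u|.
Proof.
elim: n u => [|n IH] u; first by rewrite /= normr0 mul0r.
rewrite YS yS normrZ gtr0_norm ?invr_gt0//.
rewrite -mulrA ler_pM2l ?invr_gt0// mulrDl mul1r.
apply: le_trans (ler_normD _ _) _; rewrite lerD// expr2 -mulrA.
by apply: le_trans (IH _) _; rewrite ler_wpM2l//; case/andP: (y_bound n).
Qed.

Let Y_step n u : `|Y n.+1 u - Y n u| <= (y n.+1 - y n) * `|u|.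
Proof.
elim: n u => [|n IH] u.
  have -> : Y 0 u = 0 by [].
  have -> : y 0 = 0 by [].
  by rewrite !subr0; exact: Y_le.
(* The iterates commute, so the difference of two squares factors as difference times sum; the
   increments of [y] factor in the same way. *)
have -> : Y n.+2 u - Y n.+1 u =
    2^-1 *: (Y n.+1 (Y n.+1 u + Y n u) - Y n (Y n.+1 u + Y n u)).
  rewrite [LHS](_ : _ = 2^-1 *: (Z u + Y n.+1 (Y n.+1 u)) -
     2^-1 *: (Z u + Y n (Y n u)))// -scalerBr; congr (_ *: _).
  rewrite !(boundedD (bY _)) (YY_comm n.+1 n).
  by rewrite opprD addrACA subrr add0r opprD addrA addrK.
rewrite normrZ gtr0_norm ?invr_gt0//.
apply: le_trans (_ : 2^-1 * ((y n.+1 - y n) * ((y n.+1 + y n) * `|u|)) <= _).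
  rewrite ler_pM2l ?invr_gt0//; apply: le_trans (IH _) _.
  rewrite ler_wpM2l ?subr_ge0//; apply: le_trans (ler_normD _ _) _.
  by rewrite mulrDl lerD.
rewrite (_ : y n.+2 - y n.+1 = 2^-1 * ((y n.+1 - y n) * (y n.+1 + y n))).
  by rewrite !mulrA.
by rewrite (yS n.+1); have := yS n; lra.
Qed.

Let Y_dist n m u : (n <= m)%N -> `|Y m u - Y n u| <= (y m - y n) * `|u|.
Proof.
elim: m => [|m IH]; first by rewrite leqn0 => /eqP ->; rewrite !subrr normr0 mul0r.
rewrite leq_eqVlt => /predU1P[->|]; first by rewrite !subrr normr0 mul0r.
rewrite ltnS => /IH h; have -> : Y m.+1 u - Y n u =
  (Y m.+1 u - Y m u) + (Y m u - Y n u) by rewrite addrA subrK.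
apply: le_trans (ler_normD _ _) _; have := Y_step m u; lra.
Qed.

Let y_cvg : cvgn y.
Proof.
apply: nondecreasing_is_cvgn.
  by apply/nondecreasing_seqP => n; exact: y_le.
by exists 1 => _ [n _ <-]; case/andP: (y_bound n).
Qed.

Let Y_cvg u : exists l : H, Y n u @[n --> \oo] --> l.
Proof.
apply: cauchy_seq_cvg => e e0.
have e'0 : 0 < e / (2 * (`|u| + 1)).
  by rewrite divr_gt0// mulr_gt0// ltr_wpDl.
have /cvgrPdist_lt/(_ _ e'0)[N _ hN] := y_cvg.
exists N.
have W m n : (N <= n)%N -> (n <= m)%N -> `|Y m u - Y n u| < e.
  move=> Nn nm; apply: le_lt_trans (Y_dist u nm) _.
  have := hN n Nn; have := hN m (leq_trans Nn nm) => /= h1 h2.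
  have h3 : y m - y n <= e / (`|u| + 1).
    rewrite (_ : e / (`|u| + 1) = e / (2 * (`|u| + 1)) + e / (2 * (`|u| + 1))).
      move: h1 h2; rewrite !ltr_norml => /andP[? ?] /andP[? ?]; lra.
    by field; rewrite gt_eqF// ltr_wpDl.
  apply: le_lt_trans (ler_wpM2r _ h3) _ => //.
  by rewrite mulrAC ltr_pdivrMr ?ltr_wpDl// ltr_pM2l// ltrDl.
move=> m n Nm Nn; case/orP: (leq_total n m) => nm; first exact: W.
by rewrite distrC; exact: W.
Qed.

Lemma contraction_sqrt : exists L : H -> H,
  [/\ bounded_op L, forall u v, inner (L u) v = inner u (L v),
      forall u, `|L u| <= `|u|,
      forall u, L u = 2^-1 *: (Z u + L (L u)) &
      forall D, bounded_op D -> (forall u, D (Z u) = Z (D u)) ->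
        forall u, D (L u) = L (D u)].
Proof.
have /choice[L hL] := Y_cvg; exists L.
have L1 u : `|L u| <= `|u|.
  have c1 : `|Y n u| @[n --> \oo] --> `|L u| by apply: cvg_norm.
  have c2 : (fun=> `|u|) @ \oo --> `|u| by exact: cvg_cst.
  apply: (ler_cvg_to c1 c2); apply: nearW => n; apply: le_trans (Y_le _ _) _.
  by rewrite ler_piMl//; case/andP: (y_bound n).
have sL u v : inner (L u) v = inner u (L v).
  have h1 := innerl_cvg (b := v) (hL u).
  have h2 := innerl_cvg (b := u) (hL v).
  rewrite innerC in h2.
  have E : (fun n => inner (Y n u) v) = (fun n => inner (Y n v) u).
    by apply/funext => n; rewrite sY innerC.
  rewrite E in h1; exact: (@cvg_unique _ (@norm_hausdorff _ R^o) _ _ _ _ h1 h2).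
have bL : bounded_op L.
  split; last by exists 1 => u; rewrite mul1r.
  move=> a u v.
  have h := hL (a *: u + v).
  rewrite (_ : (fun n => _) = (fun n => a *: Y n u + Y n v)) in h; last first.
    by apply/funext => n; rewrite (bY n).1.
  apply: (@cvg_unique _ (@norm_hausdorff _ H) _ _ _ _ h).
  by apply: cvgD => //; apply: cvgZr.
split=> // [u|D bD DZ u].
(* Tested weakly: self-adjointness turns [<Y n (Y n u), v>] into [<Y n u, Y n v>], which avoids a
   limit of composed operators. *)
- apply: inner_ext => v; rewrite innerZl innerDl (sL (L u)).
  have h1 : inner (Y n.+1 u) v @[n --> \oo] --> inner (L u) v.
    by apply: innerl_cvg; have := hL u; rewrite -(cvg_shiftn 1%N); under eq_fun do rewrite addn1.
  have h2 : 2^-1 * (inner (Z u) v + inner (Y n u) (Y n v)) @[n --> \oo] -->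
      2^-1 * (inner (Z u) v + inner (L u) (L v)).
    apply: cvgMr; apply: cvgD; first exact: cvg_cst.
    exact: inner_cvg.
  have E : (fun n => inner (Y n.+1 u) v) =
      (fun n => 2^-1 * (inner (Z u) v + inner (Y n u) (Y n v))).
    by apply/funext => n; rewrite YS innerZl innerDl sY.
  by rewrite -(cvg_lim _ h1)// E; apply: cvg_lim.
- have h := bounded_cvg bD (hL u).
  rewrite (_ : (fun n => _) = (fun n => Y n (D u))) in h; last first.
    by apply/funext => n; rewrite Y_comm.
  exact: (@cvg_unique _ (@norm_hausdorff _ H) _ _ _ _ h (hL (D u))).
Qed.

End contraction.

(** If [c] bounds [T], then [Z = I - T / c] lies between 0 and [I], and [S = sqrt c (I - L)] squares
    to [c (I - Z) = T]. The commutation clause serves the uniqueness proof, which can treat only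
    commuting roots directly. *)
Lemma positive_sqrt_commutes (T : H -> H) : positive_op T ->
  exists S : H -> H, [/\ positive_op S, S \o S = T &
    forall D, bounded_op D -> (forall u, D (T u) = T (D u)) ->
      forall u, D (S u) = S (D u)].
Proof.
move=> [bT sT pT]; have [c c0 hc] := bounded_op_gt0 bT.
pose Z u := u + (- c^-1) *: T u.
have bZ : bounded_op Z by apply: bounded_add (@bounded_id _ H) (bounded_scale _ bT).
have sZ u v : inner (Z u) v = inner u (Z v).
  by rewrite /Z innerDl innerDr innerZl innerZr sT.
have Zle u : inner (Z u) u <= `|u| ^+ 2.
  rewrite /Z innerDl innerZl sqr_norm mulNr lerBlDr lerDl.
  by rewrite mulr_ge0// invr_ge0 ltW.
have Zge u : 0 <= inner (Z u) u.
  rewrite /Z innerDl innerZl -sqr_norm mulNr subr_ge0 ler_pdivrMl//.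
  apply: le_trans (ler_norm _) _; apply: le_trans (inner_CauchySchwarz _ _) _.
  by rewrite expr2 mulrA ler_wpM2r.
have Z1 u : `|Z u| <= `|u|.
  apply: le_norm_inner => // v.
  rewrite -(@ler_pXn2r _ 2)// ?nnegrE ?mulr_ge0// exprMn real_normK ?num_real//.
  apply: le_trans (positive_CauchySchwarz _ _ bZ.1 sZ Zge) _.
  by rewrite ler_pM.
have [L [bL sL L1 LE Lc]] := contraction_sqrt bZ sZ Z1.
pose S u := Num.sqrt c *: (u + (-1) *: L u).
exists S; split.
- split.
  + apply: bounded_scale; apply: bounded_add (@bounded_id _ H) (bounded_scale _ bL).
  + move=> u v.
    by rewrite /S innerZl innerZr innerDl innerDr innerZl innerZr sL.
  + move=> u; rewrite /S innerZl mulr_ge0 ?sqrtr_ge0//.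
    rewrite innerDl innerZl mulN1r -sqr_norm subr_ge0.
    apply: le_trans (ler_norm _) _; apply: le_trans (inner_CauchySchwarz _ _) _.
    by rewrite expr2 ler_wpM2r.
- apply/funext => u; rewrite /S /= (boundedZ bL) (boundedD bL) (boundedZ bL).
  have -> : L (L u) = 2 *: L u - Z u.
    by rewrite {2}(LE u) scalerA divff// scale1r addrC addKr.
  have cs : Num.sqrt c * Num.sqrt c = c by rewrite -expr2 sqr_sqrtr// ltW.
  rewrite /Z; apply: inner_ext => v.
  rewrite !(innerDl, innerZl, innerNl).
  transitivity (Num.sqrt c * Num.sqrt c * (c^-1 * inner (T u) v)); first by ring.
  by rewrite cs mulrA divff ?mul1r// gt_eqF.
- move=> D bD DT u; rewrite /S (boundedZ bD) (boundedD bD) (boundedZ bD) Lc//.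
  by move=> w; rewrite /Z (boundedD bD) (boundedZ bD) DT.
Qed.

(** For commuting roots, [v = S1 u - S2 u] satisfies [S1 v + S2 v = 0]; both forms are nonnegative,
    so [S1 v = S2 v = 0] and [|v|^2 = <u, S1 v - S2 v> = 0]. Two arbitrary roots are each compared
    with the root [Q], which commutes with everything that commutes with the square. *)
Lemma positive_sqrt_unique (S S' : H -> H) : positive_op S -> positive_op S' ->
  S \o S = S' \o S' -> S = S'.
Proof.
have main (S1 S2 : H -> H) : positive_op S1 -> positive_op S2 ->
    S1 \o S1 = S2 \o S2 -> (forall u, S1 (S2 u) = S2 (S1 u)) -> S1 = S2.
  move=> [b1 s1 p1] [b2 s2 p2] e c; apply/funext => u.
  have e' w : S1 (S1 w) = S2 (S2 w) by exact: (congr1 (fun f => f w) e).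
  pose v := S1 u - S2 u.
  have h : S1 v + S2 v = 0.
    rewrite /v (boundedB b1) (boundedB b2) e' c addrA subrK; exact: subrr.
  have h' : inner (S1 v) v + inner (S2 v) v = 0 by rewrite -innerDl h inner0l.
  have S1v : S1 v = 0.
    apply: positive_form_eq0 => //; first exact: b1.1.
    by have := p1 v; have := p2 v; lra.
  have S2v : S2 v = 0.
    apply: positive_form_eq0 => //; first exact: b2.1.
    by have := p1 v; have := p2 v; lra.
  apply/eqP; rewrite -subr_eq0; apply/eqP/inner_eq0.
  by rewrite -/v {1}/v innerBl s1 s2 S1v S2v subrr.
move=> pS pS' SS.
have bSS : positive_op (S \o S).
  case: pS => b s p; split; first exact: bounded_comp.
  - by move=> u v /=; rewrite !s.
  - by move=> u /=; rewrite s inner_ge0.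
have [Q [pQ QQ Qc]] := positive_sqrt_commutes bSS.
rewrite (main S Q)//; last first.
  by move=> u; apply: Qc => //; case: pS.
apply/esym/main => //; first by rewrite QQ.
by move=> u; apply: Qc => //; [case: pS'|rewrite SS].
Qed.

Lemma sqrt_opP (T : H -> H) : positive_op T ->
  positive_op (sqrt_op T) /\ sqrt_op T \o sqrt_op T = T.
Proof.
move=> /positive_sqrt_commutes[S [pS SS _]].
by rewrite /sqrt_op; case: xgetP => [S' _ //|/(_ S)]; case.
Qed.

End square_root.

(** * The reconstruction map as a linear gain *)


Section dual_evaluation.
Context (R : realType) (K : hilbertType R).

Lemma dual_eval_le (f : dual K) v : `|f v| <= `|f| * `|v|.
Proof.
have bf := dual_bounded_op f.
have [v0|v0] := eqVneq v 0; first by rewrite v0 (bounded0 bf) !normr0 mulr0.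
have vp : 0 < `|v| by rewrite normr_gt0.
rewrite -ler_pdivrMr// mulrC.
have -> : `|v|^-1 * `|f v| = `|f (`|v|^-1 *: v)|.
  by rewrite (boundedZ bf) normrZ normfV normr_id.
apply: ub_le_sup; last first.
  by exists (`|v|^-1 *: v) => //=; rewrite normrZ normfV normr_id mulVf// gt_eqF.
have [C C0 hC] := bounded_op_gt0 bf.
exists C => _ [u /= u1 <-]; apply: le_trans (hC u) _.
by rewrite ler_piMr// ltW.
Qed.

Lemma dual_norm_ler (f : dual K) c :
  0 <= c -> (forall u, `|f u| <= c * `|u|) -> `|f| <= c.
Proof.
move=> c0 hc; apply: ge_sup.
  by exists `|f 0|, 0 => //=; rewrite normr0.
move=> _ [u /= u1 <-]; apply: le_trans (hc u) _.
by rewrite ler_piMr.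
Qed.

Lemma dual_eval_bounded v : bounded_op (fun f : dual K => f v : R^o).
Proof.
split; first by move=> a f g; rewrite dualDE dualZE.
by exists `|v| => f; rewrite mulrC dual_eval_le.
Qed.

Lemma dualNE (f : dual K) v : (- f) v = - f v.
Proof. by rewrite (boundedN (dual_eval_bounded v)). Qed.

Lemma dualBE (f g : dual K) v : (f - g) v = f v - g v.
Proof. by rewrite dualDE dualNE. Qed.

Lemma dual_ext (f g : dual K) : (forall v, f v = g v) -> f = g.
Proof. by move=> fg; apply: val_inj; apply/funext. Qed.

Lemma adjoint_to_dualE (Y : hilbertType R) (T : K -> Y) : bounded_op T ->
  forall y v, adjoint_to_dual T y v = inner y (T v).
Proof.
move=> bT y v; rewrite /adjoint_to_dual.
have h : (fun v => inner y (T v)) \in @dual_pred R K.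
  apply/mem_set; split; first by move=> a u w; rewrite bT.1 innerDr innerZr.
  have [C C0 hC] := bounded_op_gt0 bT; exists (`|y| * C) => u.
  by apply: le_trans (inner_CauchySchwarz _ _) _; rewrite -mulrA ler_wpM2l.
by have := @insubdK _ _ (dual K) 0 _ h => /(congr1 (fun f => f v)).
Qed.

Lemma adjoint_to_dual_bounded (Y : hilbertType R) (T : K -> Y) :
  bounded_op T -> bounded_op (adjoint_to_dual T).
Proof.
move=> bT; split.
  move=> a y z; apply: dual_ext => v.
  by rewrite dualDE dualZE !adjoint_to_dualE// innerDl innerZl.
have [C C0 hC] := bounded_op_gt0 bT; exists C => y.
apply: dual_norm_ler => [|v]; first by rewrite mulr_ge0// ltW.
rewrite adjoint_to_dualE//; apply: le_trans (inner_CauchySchwarz _ _) _.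
by rewrite (mulrC C) -mulrA ler_wpM2l.
Qed.

Lemma adjoint_from_dualP (X : hilbertType R) (T : X -> K) : bounded_op T ->
  forall f v, inner (adjoint_from_dual T f) v = f (T v).
Proof.
move=> bT f; have bf := dual_bounded_op f; apply: rieszP.
  by move=> a x y; rewrite bT.1 bf.1.
have [C C0 hC] := bounded_op_gt0 bT; exists (`|f| * C) => v.
apply: le_trans (dual_eval_le _ _) _.
by rewrite -mulrA ler_wpM2l.
Qed.

End dual_evaluation.

Lemma inv_opK (R : realType) (U V : normedModType R) (T : U -> V) :
  injective T -> cancel T (inv_op T).
Proof.
move=> iT u; rewrite /inv_op; apply: pinvKV; last by rewrite inE.
by move=> ? ? _ _; exact: iT.
Qed.

Lemma inv_op_rangeK (R : realType) (U V : normedModType R) (T : U -> V) z :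
  range T z -> T (inv_op T z) = z.
Proof. by move=> h; rewrite /inv_op; apply: pinvK; rewrite inE. Qed.

Section gain.
Context (R : realType) (X Y K : hilbertType R).
Variables (A : X -> Y) (Seps : Y -> Y) (iota : K -> Y).
Hypothesis bA : bounded_op A.
Hypothesis bSeps : bounded_op Seps.
Hypothesis Seps_inj : injective Seps.
Hypothesis Seps_sym : forall u v, inner (Seps u) v = inner u (Seps v).
Hypothesis Seps_ge0 : forall u, 0 <= inner (Seps u) u.
Hypothesis biota : bounded_op iota.
Hypothesis iota_inj : injective iota.

Lemma Seps_form_eq0 w : inner (Seps w) w = 0 -> w = 0.
Proof.
move=> h; apply: Seps_inj; rewrite (bounded0 bSeps).
by apply: positive_form_eq0 => //; exact: bSeps.1.
Qed.

Section fixed_prior.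
Variable B : X -> X.
Hypothesis admB : admissible A Seps iota B.

Let bB : bounded_op B. Proof. by case: admB => -[]. Qed.

Let sB u v : inner (B u) v = inner u (B v).
Proof. by case: admB => -[]. Qed.

Definition whitened : X -> K := inv_op (Seps \o iota) \o A \o B.
Local Notation C := whitened.

Let bSi : bounded_op (Seps \o iota). Proof. exact: bounded_comp. Qed.

Let iSi : injective (Seps \o iota).
Proof. by move=> u v /Seps_inj/iota_inj. Qed.

Lemma whitenedE u : Seps (iota (C u)) = A (B u).
Proof.
apply: (@inv_op_rangeK _ _ _ (Seps \o iota)).
by case: admB => _; apply; exists u.
Qed.

(** The inverse of [Seps \o iota] is unbounded in general, but composing [C] with this injective
    bounded map gives the bounded [A \o B], so the closed graph theorem applies. *)
Lemma whitened_bounded : bounded_op C.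
Proof.
exact: (bounded_factor (bounded_comp bA bB) bSi iSi whitenedE).
Qed.
Let bC := whitened_bounded.

(** This is [B A^* Seps^-1 A B]: since [A B = Seps iota C], the inverse of [Seps] is absorbed into
    [iota \o C]. *)
Definition information (u : X) : X := B (adjoint A (iota (C u))).
Local Notation G := information.

Lemma informationE u v : inner (G u) v = inner (iota (C u)) (Seps (iota (C v))).
Proof. by rewrite /G sB adjointP// whitenedE. Qed.

Lemma information_positive : positive_op G.
Proof.
split.
- exact: (bounded_comp bB (bounded_comp (adjoint_bounded bA)
    (bounded_comp biota bC))).
- by move=> u v; rewrite informationE [RHS]innerC informationE innerC Seps_sym.
- by move=> u; rewrite informationE innerC.
Qed.

Definition resolvent : X -> X := inv_op (fun u => G u + u).
Local Notation Rs := resolvent.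

Lemma resolventP r : G (Rs r) + Rs r = r.
Proof.
apply: (@inv_op_rangeK _ _ _ (fun u => G u + u)).
by have [u <-] := positive_add_id_surj information_positive r; exists u.
Qed.

Lemma resolvent_sym r s : inner (Rs r) s = inner r (Rs s).
Proof.
have [_ sG _] := information_positive.
by rewrite -{1}(resolventP s) -{2}(resolventP r) innerDl innerDr sG.
Qed.

Lemma resolvent_bounded : bounded_op Rs.
Proof.
have [bG sG pG] := information_positive; split.
  move=> a u v; apply: (positive_add_id_inj information_positive).
  rewrite resolventP bG.1 addrACA -scalerDr !resolventP//.
exists 1 => u; rewrite mul1r.
have [->|r0] := eqVneq (Rs u) 0; first by rewrite normr0.
have rp : 0 < `|Rs u| by rewrite normr_gt0.
rewrite -(ler_pM2r rp) -expr2 sqr_norm.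
apply: le_trans (_ : inner u (Rs u) <= _).
  by rewrite -{3}(resolventP u) innerDl lerDr.
by apply: le_trans (ler_norm _) _; exact: inner_CauchySchwarz.
Qed.

Definition gain (f : dual K) : X := B (Rs (adjoint_from_dual C f)).
Local Notation W := gain.

Definition gain_coef (e : X) : K := C (Rs (B e)).
Local Notation k := gain_coef.

Lemma reconE h y : recon A Seps iota h B y = h + W (y - adjoint_to_dual iota (A h)).
Proof.
rewrite /recon /W /Rs /G; congr (_ + B (inv_op _ _)).
by apply/funext => u; rewrite -whitenedE inv_opK.
Qed.

Lemma gainE f e : inner (W f) e = f (k e).
Proof. by rewrite /W sB resolvent_sym adjoint_from_dualP. Qed.

Lemma gain_bounded : bounded_op W.
Proof.
split.
  move=> a f g; apply: inner_ext => e.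
  by rewrite innerDl innerZl !gainE dualDE dualZE.
have bk : bounded_op k.
  exact: (bounded_comp bC (bounded_comp resolvent_bounded bB)).
have [c c0 hc] := bounded_op_gt0 bk; exists c => f.
apply: le_norm_inner => [|e]; first by rewrite mulr_ge0// ltW.
rewrite gainE; apply: le_trans (dual_eval_le _ _) _.
by rewrite (mulrC c) -mulrA ler_wpM2l.
Qed.

(** Apply [A \o B] to [G r + r = B e] with [r = Rs (B e)]: the term in [G r] is the first summand,
    and [A (B r) = Seps (iota (C r))] is the second. *)
Lemma gain_coefE e :
  A (B (B (adjoint A (iota (k e))))) + Seps (iota (k e)) = A (B (B e)).
Proof.
by rewrite -/(G _) whitenedE -(boundedD bA) -(boundedD bB) resolventP.
Qed.

(** Identifies the adjoint of [I - W iota^* A]: it sends [e] to the vector [- a] of the bias term,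
    so vanishing bias becomes a statement about the kernel of [I - W iota^* A]. *)
Lemma gain_data_inner v e :
  inner (v - W (adjoint_to_dual iota (A v))) e =
  inner v (e - adjoint A (iota (k e))).
Proof.
rewrite innerBl gainE adjoint_to_dualE// innerBr; congr (_ - _).
by rewrite [RHS]innerC adjointP// innerC.
Qed.

(* If [v = W iota^* A v] then [v = B s] with [(G + I) s = C^* iota^* A B s = G s],
   so [s = 0]. *)
Lemma gain_data_inj v : v - W (adjoint_to_dual iota (A v)) = 0 -> v = 0.
Proof.
move/eqP; rewrite subr_eq0 => /eqP vE.
set s := Rs (adjoint_from_dual C (adjoint_to_dual iota (A v))).
have vs : v = B s by [].
suff s0 : s = 0 by rewrite vs s0 (bounded0 bB).
have Gs : adjoint_from_dual C (adjoint_to_dual iota (A v)) = G s.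
  apply: inner_ext => u; rewrite adjoint_from_dualP// adjoint_to_dualE//.
  have [_ sG _] := information_positive.
  by rewrite sG (innerC s) informationE whitenedE -vs innerC.
have := resolventP (adjoint_from_dual C (adjoint_to_dual iota (A v))).
by rewrite -/s Gs => h; apply: (addrI (G s)); rewrite addr0.
Qed.

End fixed_prior.

(** The orthogonal complement of the kernel contains the range of [A^*], so [B1^2 A^* = B2^2 A^*]
    and, by transposition, [A B1^2 = A B2^2]. Both coefficients then solve one equation, whose
    operator [A B2^2 A^* + Seps] is strictly positive. *)
Lemma prior_eq_gain_coef B1 B2 :
  admissible A Seps iota B1 -> admissible A Seps iota B2 ->
  (forall u, orthocomp (A @^-1` [set 0]) u -> B1 (B1 u) = B2 (B2 u)) ->
  forall e, gain_coef B1 e = gain_coef B2 e.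
Proof.
move=> a1 a2 BB e; have [[b1 s1 p1] _] := a1; have [[b2 s2 p2] _] := a2.
have BA w : B1 (B1 (adjoint A w)) = B2 (B2 (adjoint A w)).
  by apply: BB => v /= Av; rewrite adjointP// Av inner0r.
have AB v : A (B1 (B1 v)) = A (B2 (B2 v)).
  apply: inner_ext => w.
  by rewrite innerC -adjointP// -s1 -s1 BA s2 s2 adjointP// innerC.
have := gain_coefE a1 e; rewrite !AB -(gain_coefE a2 e).
move: (gain_coef B1 e) (gain_coef B2 e) => k1 k2 /eqP.
rewrite -subr_eq0 opprD addrACA => /eqP h.
apply: iota_inj; apply/eqP; rewrite -subr_eq0; apply/eqP; apply: Seps_form_eq0.
set w := iota k1 - iota k2.
have bA' := adjoint_bounded bA.
have : inner (A (B2 (B2 (adjoint A w))) + Seps w) w = 0.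
  by rewrite /w (boundedB bA') !(boundedB b2) (boundedB bA) (boundedB bSeps) h inner0l.
rewrite innerDl.
rewrite [X in X + _ = _]innerC -adjointP// -s2 => h0.
have := inner_ge0 (B2 (adjoint A w)); have := Seps_ge0 w; lra.
Qed.

(** With [D = B1^2 - B2^2], subtracting the two equations for a common coefficient gives
    [A D (e - A^* iota k_e) = 0] for all [e]. Its transpose is [(I - W iota^* A) D A^* = 0], and
    injectivity of the first factor yields [D A^* = 0], hence [A D = 0]. *)
Lemma gain_coef_prior_eq B1 B2 :
  admissible A Seps iota B1 -> admissible A Seps iota B2 ->
  (forall e, gain_coef B1 e = gain_coef B2 e) ->
  forall u, orthocomp (A @^-1` [set 0]) u -> B1 (B1 u) = B2 (B2 u).
Proof.
move=> a1 a2 k12; have [[b1 s1 p1] _] := a1; have [[b2 s2 p2] _] := a2.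
pose D u := B1 (B1 u) - B2 (B2 u).
have sD u v : inner (D u) v = inner u (D v).
  by rewrite /D innerBl innerBr !s1 !s2.
have ADk e : A (D (e - adjoint A (iota (gain_coef B1 e)))) = 0.
  have h1 := gain_coefE a1 e; have h2 := gain_coefE a2 e.
  rewrite -k12 in h2; rewrite /D (boundedB bA).
  rewrite !(boundedB b1) !(boundedB b2) !(boundedB bA) -h1 -h2.
  by rewrite (addrC _ (Seps _)) addrK (addrC _ (Seps _)) addrK subrr.
have DA w : D (adjoint A w) = 0.
  apply: (gain_data_inj a1); apply: inner_ext => e.
  by rewrite gain_data_inner// sD adjointP// ADk inner0r inner0l.
have AD v : A (D v) = 0.
  apply: inner_ext => w; rewrite innerC -adjointP// -sD DA.
  by rewrite !inner0l.
move=> u uo; apply/eqP; rewrite -subr_eq0; apply/eqP; rewrite -/(D u).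
apply: inner_ext => v; rewrite sD inner0l; apply: uo; exact: AD.
Qed.

End gain.

(** * Orthonormal sequences and Borel measurability *)


Section orthonormal_sequences.
Context (R : realType) (H : hilbertType R).

(** Distinct basis vectors are at distance [sqrt 2], so a point of the dense set within 1/2 of a
    basis vector determines that vector. *)
Lemma hilbert_basis_countable (E : set H) :
  separable H -> hilbert_basis E -> countable E.
Proof.
move=> [D [cD dD]] [oE _].
have /choice[p hp] (e : H) : exists f : H, D f /\ ball e 2^-1 f.
  have [] := dD (ball e 2^-1); last by move=> f [ef Df]; exists f.
    by exists e; apply: ballxx; rewrite invr_gt0.
  by apply: ball_open; rewrite invr_gt0.
have /countable_injP[q iq] := cD.
apply/countable_injP; exists (q \o p) => e f /set_mem Ee /set_mem Ef.
move=> /(iq _ _ (mem_set (hp e).1) (mem_set (hp f).1)) pef.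
apply/eqP; apply/negPn/negP => ef.
have h1 : `|e - f| < 1.
  have := (hp e).2; have := (hp f).2; rewrite -!ball_normE /= pef => hf he.
  rewrite (_ : e - f = (e - p f) - (f - p f)); last by rewrite opprB addrA subrK.
  by apply: le_lt_trans (ler_normB _ _) _; lra.
have : inner (e - f) (e - f) = 2.
  rewrite innerBl !innerBr (oE e e)// (oE e f)// (oE f e)// (oE f f)//.
  by rewrite !eqxx (eq_sym f) (negbTE ef) /=; lra.
rewrite -sqr_norm => h2; have : `|e - f| ^+ 2 < 1 by rewrite expr_lt1.
by rewrite h2; lra.
Qed.

(* A countable orthonormal basis enumerated by [nat], padded with zeros. *)
Definition padded_basis (g : nat -> H) :=
  [/\ forall n m, n <> m -> inner (g n) (g m) = 0,
      forall n v, inner v (g n) * inner (g n) (g n) = inner v (g n) &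
      forall u, (forall n, inner u (g n) = 0) -> u = 0].

(** The basis may be finite and the injection into [nat] need not be onto; [xget] puts 0 at the
    indices that are missed. *)
Lemma separable_padded_basis (E : set H) :
  separable H -> hilbert_basis E -> exists g, padded_basis g.
Proof.
move=> sH bE; have /countable_injP[q iq] := hilbert_basis_countable sH bE.
have [oE tE] := bE.
pose g n := xget 0 [set e | E e /\ q e = n].
have gP n : (E (g n) /\ q (g n) = n) \/ g n = 0.
  by rewrite /g; case: xgetP => [e _ ?|_]; [left|right].
exists g; split=> [n m nm|n v|u hu].
- case: (gP n) => [[En qn]|->]; last by rewrite inner0l.
  case: (gP m) => [[Em qm]|->]; last by rewrite inner0r.
  rewrite oE//; case: eqVneq => // gnm; case: nm.
  by rewrite -qn gnm qm.
- case: (gP n) => [[En qn]|->]; last by rewrite !inner0r mulr0.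
  by rewrite (oE (g n) (g n))// eqxx mulr1.
- suff : orthocomp E u by rewrite tE.
  move=> e Ee; have [En qn] : E (g (q e)) /\ q (g (q e)) = q e.
    by apply: (@xgetPex _ 0 [set f | E f /\ q f = q e]); exists e.
  by have := hu (q e); rewrite (iq _ _ (mem_set En) (mem_set Ee) qn).
Qed.

(** Bessel's identity [us] bounds the sums of squares, so the Fourier partial sums are Cauchy; their
    limit has the coefficients of [u], hence equals [u] by totality, and the Bessel defect tends to
    0. *)
Lemma parseval (g : nat -> H) : padded_basis g -> forall u,
  ((`|u| ^+ 2)%:E = \sum_(n <oo) (inner u (g n) ^+ 2)%:E)%E.
Proof.
move=> [og ng tg] u.
pose c n := inner u (g n).
pose s n := \sum_(i < n) c i *: g i.
pose a n := \sum_(i < n) c i ^+ 2.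
have sS n : s n.+1 = s n + c n *: g n by rewrite /s big_ord_recr.
have aS n : a n.+1 = a n + c n ^+ 2 by rewrite /a big_ord_recr.
have s0 : s 0%N = 0 by rewrite /s big_ord0.
have a0 : a 0%N = 0 by rewrite /a big_ord0.
have sg n j : inner (s n) (g j) = if (j < n)%N then c j else 0.
  elim: n => [|n IH]; first by rewrite s0 inner0l.
  rewrite sS innerDl innerZl IH ltnS.
  have [->|jn] := eqVneq j n; first by rewrite ltnn leqnn add0r ng.
  have -> : inner (g n) (g j) = 0 by apply: og => nj; rewrite nj eqxx in jn.
  by rewrite mulr0 addr0 [in RHS]leq_eqVlt (negbTE jn).
(* Treats unit vectors and padding zeros together: [c n] vanishes wherever [g n] does. *)
have cg n : c n * (c n * inner (g n) (g n)) = c n * c n by rewrite {2}/c ng.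
have us n : `|u - s n| ^+ 2 = `|u| ^+ 2 - a n.
  elim: n => [|n IH]; first by rewrite s0 a0 !subr0.
  have -> : u - s n.+1 = (u - s n) + (- c n) *: g n.
    by rewrite sS opprD addrA scaleNr.
  rewrite sqr_normD IH aS sqr_norm !innerZr !innerZl innerBl sg ltnn subr0.
  by have := cg n; rewrite -/(c n); lra.
have sm n m : (n <= m)%N -> `|s m - s n| ^+ 2 = a m - a n.
  elim: m => [|m IH]; first by rewrite leqn0 => /eqP ->; rewrite !subrr normr0 expr0n.
  rewrite leq_eqVlt => /predU1P[->|]; first by rewrite !subrr normr0 expr0n.
  rewrite ltnS => nm.
  have -> : s m.+1 - s n = (s m - s n) + c m *: g m by rewrite sS addrAC.
  rewrite sqr_normD IH// aS sqr_norm !innerZr !innerZl innerBl !sg ltnn.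
  by rewrite ltnNge nm /=; have := cg m; lra.
have a_le n : a n <= `|u| ^+ 2 by have := us n; have := sqr_ge0 `|u - s n|; lra.
have a_cvg : cvgn a.
  apply: nondecreasing_is_cvgn.
    by apply/nondecreasing_seqP => n; rewrite aS lerDl sqr_ge0.
  by exists (`|u| ^+ 2) => _ [n _ <-].
have [l sl] : exists l : H, s @ \oo --> l.
  apply: cauchy_seq_cvg => e e0.
  have e2 : 0 < e ^+ 2 / 2 by rewrite divr_gt0// exprn_gt0.
  have /cvgrPdist_lt/(_ _ e2)[N _ hN] := a_cvg.
  exists N.
  have W m n : (N <= n)%N -> (n <= m)%N -> `|s m - s n| < e.
    move=> Nn nm; rewrite -(@ltr_pXn2r _ 2) ?nnegrE ?(ltW e0)// sm//.
    have := hN n Nn; have := hN m (leq_trans Nn nm) => /=.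
    by rewrite !ltr_norml => /andP[? ?] /andP[? ?]; lra.
  move=> m n Nm Nn; case/orP: (leq_total n m) => nm; first exact: W.
  by rewrite distrC; exact: W.
have ul : u = l.
  apply/eqP; rewrite -subr_eq0; apply/eqP; apply: tg => j.
  rewrite innerBl; apply/eqP; rewrite subr_eq0; apply/eqP.
  have h1 := innerl_cvg (b := g j) sl.
  rewrite -(cvg_lim _ h1)//; apply/esym/cvg_lim => //.
  apply: (@cvg_trans _ ((fun=> c j) @ \oo)); last exact: cvg_cst.
  apply: near_eq_cvg; exists j.+1 => // n /= jn.
  by rewrite sg jn.
have ac : a @ \oo --> `|u| ^+ 2.
  rewrite (_ : a = (fun n => `|u| ^+ 2 - `|u - s n| ^+ 2)); last first.
    by apply/funext => n; rewrite us; ring.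
  rewrite -[X in _ --> X]subr0; apply: cvgB; first exact: cvg_cst.
  rewrite [X in _ --> X](_ : 0 = `|u - l| * `|u - l|); last first.
    by rewrite ul subrr normr0 mulr0.
  by apply: cvgM; apply: cvg_norm; apply: cvgB => //; exact: cvg_cst.
apply/esym/cvg_lim => //.
rewrite (_ : (fun n => _) = EFin \o a); first by apply/cvg_EFin => //; exact: nearW.
by apply/funext => n /=; rewrite /a -sumEFin big_mkord.
Qed.

End orthonormal_sequences.

Section borel_measurability.
Context (R : realType).

Lemma continuous_borel_measurable (V : normedModType R) (f : V -> R) :
  continuous f -> measurable_fun [set: borel V] (f : borel V -> R).
Proof.
move=> cf; apply: (measurability _ (RGenOInfty.measurableE R)).
move=> _ [_ [x ->] <-]; rewrite setTI; apply: sub_sigma_algebra.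
by apply: open_comp => [y _|]; [exact: cf|exact: interval_open].
Qed.

Lemma bounded_op_continuous (U V : normedModType R) (f : U -> V) :
  bounded_op f -> continuous f.
Proof.
move=> bf u; have [C C0 hC] := bounded_op_gt0 bf.
apply/cvgrPdist_lt => e e0.
have := nbhsx_ballx u _ (divr_gt0 e0 C0); apply: filterS => t.
rewrite -ball_normE /= => h; rewrite -(boundedB bf); apply: le_lt_trans (hC _) _.
by rewrite mulrC -ltr_pdivlMr.
Qed.

Lemma inner_borel_measurable (X : hilbertType R) (v : X) :
  measurable_fun [set: borel X] (fun u : borel X => inner (u : X) v).
Proof.
apply: continuous_borel_measurable; apply: (@bounded_op_continuous X R^o).
split; first by move=> a u w; rewrite innerDl innerZl.
by exists `|v| => u; rewrite mulrC inner_CauchySchwarz.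
Qed.

Lemma dual_eval_borel_measurable (K : hilbertType R) (v : K) :
  measurable_fun [set: borel (dual K)] (fun f : borel (dual K) => (f : dual K) v : R).
Proof.
apply: continuous_borel_measurable; apply: bounded_op_continuous.
exact: dual_eval_bounded.
Qed.

Definition riesz_map (K : hilbertType R) : K -> dual K := adjoint_to_dual id.

Lemma riesz_mapE (K : hilbertType R) (u v : K) : riesz_map u v = inner u v.
Proof. by rewrite /riesz_map adjoint_to_dualE//; exact: bounded_id. Qed.

Lemma riesz_map_surj (K : hilbertType R) (f : dual K) : exists u, riesz_map u = f.
Proof.
exists (riesz f); apply: dual_ext => v; rewrite riesz_mapE.
have [lf bf] := dual_bounded_op f.
by apply: rieszP => [a x y|]; [rewrite lf|exact: bf].
Qed.

Lemma dense_approx (V : normedModType R) (D : set V) : dense D ->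
  forall (u : V) (e : R), 0 < e -> exists2 v, D v & `|u - v| < e.
Proof.
move=> dD u e e0; have [] := dD (ball u e).
- by exists u; exact: ballxx.
- exact: ball_open.
by move=> v [uv Dv]; exists v => //; move: uv; rewrite -ball_normE.
Qed.

Lemma countable_bigcup_measurable (I : Type) d (T : measurableType d)
    (D : set I) (F : I -> set T) : countable D ->
  (forall i, D i -> measurable (F i)) -> measurable (\bigcup_(i in D) F i).
Proof.
move=> /countable_injP[q iq] mF.
rewrite (_ : \bigcup_(i in D) F i =
    \bigcup_n \bigcup_(i in [set i | D i /\ q i = n]) F i); last first.
  apply/seteqP; split=> [t [i Di Ft]|t [n _ [i [Di _] Ft]]]; last by exists i.
  by exists (q i) => //; exists i.
apply: bigcupT_measurable => n.
have [[i [Di qi]]|no] := pselect (exists i, D i /\ q i = n); last first.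
  rewrite (_ : [set i | _] = set0) ?bigcup_set0//.
  by apply/seteqP; split=> // i Di; case: no; exists i.
rewrite (_ : [set i | _] = [set i]) ?bigcup_set1; first exact: mF.
apply/seteqP; split=> [j [Dj qj]|_ ->] //=.
by apply: iq; rewrite ?inE// qi qj.
Qed.

Lemma countable_bigcap_measurable (I : Type) d (T : measurableType d)
    (D : set I) (F : I -> set T) : countable D ->
  (forall i, D i -> measurable (F i)) -> measurable (\bigcap_(i in D) F i).
Proof.
move=> cD mF; rewrite -[X in measurable X]setCK setC_bigcap.
apply: measurableC; apply: countable_bigcup_measurable => // i Di.
exact/measurableC/mF.
Qed.

Lemma riesz_map_norm (K : hilbertType R) (u : K) : `|riesz_map u| <= `|u|.
Proof.
by apply: dual_norm_ler => // v; rewrite riesz_mapE inner_CauchySchwarz.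
Qed.

(* For separable [K] the Borel sigma-algebra of [K^*] is generated by the
   evaluations: an open set is a countable union of closed balls centred at Riesz
   images of a dense set, and such balls are cut out by countably many
   evaluations. *)
Lemma measurable_into_dual (K : hilbertType R) d (T : measurableType d)
    (f : T -> dual K) : separable K ->
  (forall v, measurable_fun setT (fun t => f t v : R)) ->
  measurable_fun [set: T] (f : T -> borel (dual K)).
Proof.
move=> [D [cD dD]] mf.
apply: (@measurability _ _ _ (borel (dual K)) setT f (@open (dual K)) erefl).
move=> _ [U oU <-]; rewrite setTI.
have ball_m (w : K) (q : R) : 0 <= q ->
    measurable [set t | `|f t - riesz_map w| <= q].
  move=> q0.
  rewrite (_ : [set t | _] =
    \bigcap_(v in D) [set t | `|f t v - inner w v| <= q * `|v|]); last first.
    apply/seteqP; split=> t /=.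
      move=> h v _ /=; rewrite -riesz_mapE -dualBE.
      by apply: le_trans (dual_eval_le _ _) _; rewrite ler_wpM2r.
    move=> h; apply: dual_norm_ler => // v; rewrite dualBE riesz_mapE.
    (* Replacing [v] by a nearby [u] in [D] changes the left side by at most [C |v - u|] and the
       right side by at most [q |v - u|]. *)
    apply/ler_addgt0Pr => e e0.
    have [C C0 hC] := bounded_op_gt0 (dual_bounded_op (f t - riesz_map w)).
    have Cq : 0 < C + (q + 1) by rewrite addr_gt0// ltr_wpDl.
    have [u Du uv] := dense_approx dD v (divr_gt0 e0 Cq).
    have /= := h u Du; have := hC (v - u).
    rewrite (boundedB (dual_bounded_op _)) !dualBE !riesz_mapE.
    have : `|u| <= `|v| + `|v - u|.
      by rewrite -[X in `|X| <= _](subKr v) (le_trans (ler_normB _ _)).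
    set a := f t v - _; set b := f t u - _ => h1 h2 h3.
    have h4 : `|a| <= `|b| + `|a - b|.
      by rewrite -[X in `|X| <= _](subrK b) addrC (le_trans (ler_normD _ _)).
    have h5 : `|v - u| * (C + (q + 1)) < e by rewrite -ltr_pdivlMr.
    have h6 : q * `|u| <= q * (`|v| + `|v - u|) by rewrite ler_wpM2l.
    by have := normr_ge0 (v - u); lra.
  apply: countable_bigcap_measurable => // v _.
  rewrite -[X in measurable X]setTI; apply: measurable_fun_le => //.
  apply: measurableT_comp => //; apply: measurable_funB => //; exact: mf.
pose Q w : set rat := [set q | 0 <= ratr q :> R /\
  [set g : dual K | `|g - riesz_map w| <= ratr q] `<=` U].
rewrite (_ : f @^-1` U = \bigcup_(w in D) \bigcup_(q in Q w)
    [set t | `|f t - riesz_map w| <= ratr q]); last first.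
  apply/seteqP; split=> [t /= Uft|t [w Dw [q [q0 qU] h]]]; last exact: qU.
  have /nbhs_ballP[e /= e0 eU] : nbhs (f t) U by exact: open_nbhs_nbhs.
  have [u uE] := riesz_map_surj (f t).
  (* A centre within [e / 4] and a rational radius between [e / 4] and [e / 2]: the closed ball
     contains [f t] and stays within [e / 4 + e / 2 < e] of it. *)
  have e4 : 0 < e / 4 by rewrite divr_gt0.
  have [w Dw uw] := dense_approx dD u e4.
  have [q] := @rat_in_itvoo R (e / 4) (e / 2) ltac:(lra).
  rewrite in_itv/= => /andP[q1 q2].
  have fw : `|f t - riesz_map w| < e / 4.
    apply: le_lt_trans uw; rewrite -uE.
    have bJ := adjoint_to_dual_bounded (@bounded_id _ K).
    by rewrite -(boundedB bJ) riesz_map_norm.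
  exists w => //; exists q; last exact: ltW (lt_trans fw q1).
  split; first by apply: ltW; exact: lt_trans q1.
  move=> g /= gw; apply: eU; rewrite -ball_normE /=.
  rewrite (_ : f t - g = (f t - riesz_map w) - (g - riesz_map w)); last first.
    by rewrite opprB addrA subrK.
  by apply: le_lt_trans (ler_normB _ _) _; lra.
apply: countable_bigcup_measurable => // w _.
apply: countable_bigcup_measurable => // q [q0 _]; exact: ball_m.
Qed.

End borel_measurability.

(** * Second moments and independence *)


Section second_moments.
Context (R : realType) (d : measure_display) (T : measurableType d)
  (P : probability T R).
Local Open Scope ereal_scope.

Definition finite_variance (f : T -> R) :=
  measurable_fun setT f /\ \int[P]_t (f t ^+ 2)%:E < +oo.

Lemma finite_variance_integrableM (f g : T -> R) :
  finite_variance f -> finite_variance g ->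
  P.-integrable setT (fun t => (f t * g t)%:E).
Proof.
move=> [mf If] [mg Ig].
have sq (h : T -> R) : measurable_fun setT h -> \int[P]_t (h t ^+ 2)%:E < +oo ->
    P.-integrable setT (fun t => (h t ^+ 2)%:E).
  move=> mh Ih; apply/integrableP; split.
    by apply/measurable_EFinP; exact: measurable_funX.
  by under eq_integral do rewrite gee0_abs ?lee_fin ?sqr_ge0//.
apply: (@le_integrable _ _ _ P setT measurableT _
    (fun t => (f t ^+ 2)%:E + (g t ^+ 2)%:E)).
- by apply/measurable_EFinP; exact: measurable_funM.
- move=> t _; rewrite -EFinD !abse_EFin lee_fin.
  rewrite (ger0_norm (addr_ge0 (sqr_ge0 _) (sqr_ge0 _))) ler_norml.
  have := sqr_ge0 (f t + g t); have := sqr_ge0 (f t - g t).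
  by move=> *; apply/andP; split; nra.
- by apply: integrableD => //; exact: sq.
Qed.

Lemma finite_variance_cst (c : R) : finite_variance (fun=> c).
Proof.
split; first exact: measurable_cst.
rewrite integral_cst//.
rewrite [X in _ * X](_ : _ = 1) ?mule1 ?ltry//; exact: probability_setT.
Qed.

Lemma finite_variance_integrable (f : T -> R) : finite_variance f ->
  P.-integrable setT (fun t => (f t)%:E).
Proof.
move=> vf; have := finite_variance_integrableM vf (finite_variance_cst 1).
by under eq_fun do rewrite mulr1.
Qed.

(** Independence on rectangles identifies the law of the pair with the product of the marginals;
    Fubini then integrates [g] first, and the inner integral is a multiple of its mean. *)
Lemma independent_integralM0 (f g : T -> R) :
  measurable_fun setT f -> measurable_fun setT g ->
  (forall A B, measurable A -> measurable B ->
    P (f @^-1` A `&` g @^-1` B) = P (f @^-1` A) * P (g @^-1` B)) ->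
  P.-integrable setT (fun t => (f t * g t)%:E) ->
  P.-integrable setT (fun t => (g t)%:E) ->
  \int[P]_t (g t)%:E = 0 ->
  \int[P]_t (f t * g t)%:E = 0.
Proof.
move=> mf mg fg Ifg Ig g0.
pose X : {RV P >-> R} := HB.pack f (isMeasurableFun.Build _ _ _ _ f mf).
pose Y : {RV P >-> R} := HB.pack g (isMeasurableFun.Build _ _ _ _ g mg).
have mXY : measurable_fun setT (fun t => (f t, g t)) by exact: measurable_fun_pair.
pose XY : {RV P >-> (R * R)%type} :=
  HB.pack (fun t => (f t, g t)) (isMeasurableFun.Build _ _ _ _ _ mXY).
pose h (z : R * R) : \bar R := (z.1 * z.2)%:E.
have mh : measurable_fun setT h.
  by apply/measurable_EFinP; apply: measurable_funM;
    [exact: measurable_fst|exact: measurable_snd].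
have prodE A : measurable A ->
    (distribution P X \x distribution P Y) A = distribution P XY A.
  by apply: product_measure_unique => B C mB mC; exact: fg.
have -> : \int[P]_t (f t * g t)%:E = \int[distribution P XY]_z h z.
  by rewrite integral_distribution.
have IXY : (distribution P XY).-integrable setT h by exact: integrable_pushforward.
have Iprod : (distribution P X \x distribution P Y).-integrable setT h.
  move/integrableP : IXY => [_ IXY]; apply/integrableP; split => //.
  rewrite (eq_measure_integral (distribution P XY))// => A mA _; exact: prodE.
rewrite (eq_measure_integral (distribution P X \x distribution P Y)); last first.
  by move=> A mA _; exact/esym/prodE.
rewrite -(integral12_prod_meas1 Iprod) /fubini_F /h /=.
under eq_integral => r _.
  under eq_integral do rewrite EFinM.
  rewrite integralZl//; last first.
    by apply: integrable_pushforward => //; exact: Ig.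
  rewrite integral_distribution//.
  rewrite [X in _ * X](_ : _ = 0); last exact: g0.
  rewrite mule0.
  over.
exact: integral0.
Qed.

Lemma integral_sqrD3 (f g : T -> R) (c : R) :
  finite_variance f -> finite_variance g ->
  \int[P]_t (f t)%:E = 0 -> \int[P]_t (g t)%:E = 0 ->
  \int[P]_t (f t * g t)%:E = 0 ->
  \int[P]_t ((f t + c + g t) ^+ 2)%:E =
  \int[P]_t (f t ^+ 2)%:E + \int[P]_t (g t ^+ 2)%:E + (c ^+ 2)%:E.
Proof.
move=> vf vg f0 g0 fg0.
have If := finite_variance_integrable vf.
have Ig := finite_variance_integrable vg.
have Ifg := finite_variance_integrableM vf vg.
have Iff := finite_variance_integrableM vf vf.
have Igg := finite_variance_integrableM vg vg.
have Ic := finite_variance_integrable (finite_variance_cst (c ^+ 2)).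
transitivity (\int[P]_t ((f t * f t)%:E + ((g t * g t)%:E + (2%:E * (f t * g t)%:E +
    ((2 * c)%:E * (f t)%:E + ((2 * c)%:E * (g t)%:E + (c ^+ 2)%:E)))))).
  apply: eq_integral => t _; rewrite -!EFinM -!EFinD; congr (_%:E); ring.
have I1 : P.-integrable setT (fun t => (2 * c)%:E * (g t)%:E + (c ^+ 2)%:E).
  by apply: integrableD => //; exact: integrableZl.
have I2 : P.-integrable setT (fun t => (2 * c)%:E * (f t)%:E +
    ((2 * c)%:E * (g t)%:E + (c ^+ 2)%:E)).
  by apply: integrableD => //; exact: integrableZl.
have I3 : P.-integrable setT (fun t => 2%:E * (f t * g t)%:E + ((2 * c)%:E * (f t)%:E +
    ((2 * c)%:E * (g t)%:E + (c ^+ 2)%:E))).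
  by apply: integrableD => //; exact: integrableZl.
rewrite integralD//; last exact: integrableD.
rewrite integralD// integralD//; last exact: integrableZl.
rewrite integralD//; last exact: integrableZl.
rewrite integralD//; last exact: integrableZl.
rewrite !integralZl// fg0 f0 g0 !mule0 !add0e integral_cst//.
rewrite [X in _ + (_ + _ * X)](_ : _ = 1) ?mule1 ?addeA//; exact: probability_setT.
Qed.

End second_moments.

(** * The risk as a series over an orthonormal basis *)


Lemma expectationE (R : realType) d (T : measurableType d) (P : probability T R)
  (f : T -> R) : ('E_P[f] = \int[P]_t (f t)%:E)%E.
Proof. by rewrite unlock. Qed.

Section risk_formula.
Context (R : realType) (X Y K : hilbertType R).
Context (A : X -> Y) (iota : K -> Y) (mu : X) (Sx : X -> X) (Seps : Y -> Y).
Context (d : measure_display) (T : measurableType d) (P : probability T R).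
Context (x : {RV P >-> borel X}) (noise : Y -> {RV P >-> R}).
Context (eps : {RV P >-> borel (dual K)}).
Hypothesis sepK : separable K.
Hypothesis bA : bounded_op A.
Hypothesis x_mean : is_mean P x mu.
Hypothesis x_cov : is_covariance P x mu Sx.
Hypothesis noise_cov : zero_mean_linear_process noise Seps.
Hypothesis bSeps : bounded_op Seps.
Hypothesis Seps_inj : injective Seps.
Hypothesis indep : independent_sigma P (sigma_rv x) (sigma_process noise).
Hypothesis biota : bounded_op iota.
Hypothesis iota_inj : injective iota.
Hypothesis eps_vec : noise_vector iota noise (eps : T -> dual K).

Lemma covariance_sym u v : inner (Sx u) v = inner u (Sx v).
Proof.
apply: EFin_inj; rewrite -x_cov [in RHS]innerC -x_cov !expectationE.
by apply: eq_integral => t _; rewrite mulrC.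
Qed.

Lemma covariance_ge0 u : 0 <= inner (Sx u) u.
Proof.
rewrite -lee_fin -x_cov expectationE; apply: integral_ge0 => t _.
by rewrite lee_fin -expr2 sqr_ge0.
Qed.

Lemma noise_covariance_sym u v : inner (Seps u) v = inner u (Seps v).
Proof.
have [_ _ nc] := noise_cov.
apply: EFin_inj; rewrite -nc [in RHS]innerC -nc !expectationE.
by apply: eq_integral => t _; rewrite mulrC.
Qed.

Lemma noise_covariance_ge0 u : 0 <= inner (Seps u) u.
Proof.
have [_ _ nc] := noise_cov.
rewrite -lee_fin -nc expectationE; apply: integral_ge0 => t _.
by rewrite lee_fin -expr2 sqr_ge0.
Qed.

Lemma measurable_inner_x (v : X) :
  measurable_fun setT (fun t => inner (x t : X) v).
Proof.
exact: (measurableT_comp (inner_borel_measurable v) (measurable_funPT x)).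
Qed.

Lemma measurable_centred (v : X) :
  measurable_fun setT (fun t => inner ((x t : X) - mu) v).
Proof.
under eq_fun do rewrite innerBl.
by apply: measurable_funB => //; exact: measurable_inner_x.
Qed.

Lemma centred_sq (v : X) :
  (\int[P]_t (inner ((x t : X) - mu) v ^+ 2)%:E = (inner (Sx v) v)%:E)%E.
Proof.
by rewrite -x_cov expectationE; apply: eq_integral => t _; rewrite expr2.
Qed.

Lemma centred_finite_variance (v : X) :
  finite_variance P (fun t => inner ((x t : X) - mu) v).
Proof.
by split; [exact: measurable_centred|rewrite centred_sq ltry].
Qed.

Lemma centred_mean (v : X) : (\int[P]_t (inner ((x t : X) - mu) v)%:E = 0)%E.
Proof.
have Ic := finite_variance_integrable (finite_variance_cst P (inner mu v)).
have Ix : P.-integrable setT (fun t => (inner (x t : X) v)%:E).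
  have := integrableD measurableT
    (finite_variance_integrable (centred_finite_variance v)) Ic.
  by congr (integrable _ _ _); apply/funext => t /=; rewrite -EFinD -innerDl subrK.
under eq_integral do rewrite innerBl EFinB.
rewrite integralB// -expectationE x_mean integral_cst//.
rewrite [X in (_ - _ * X)%E](_ : _ = 1%E); last exact: probability_setT.
by rewrite mule1 subee.
Qed.

Lemma measurable_eps (k : K) :
  measurable_fun setT (fun t => (eps t : dual K) k : R).
Proof.
exact: (measurableT_comp (dual_eval_borel_measurable k) (measurable_funPT eps)).
Qed.

(** Moments and independence are hypotheses on the process, not on [eps]; they are transferred for
    one [k] at a time, because the null set depends on [k]. The second argument of [h] allows
    products with functions of [x]. *)
Lemma eps_noise_integral (k : K) (h : R -> T -> R) :
  measurable_fun setT (fun t => h ((eps t : dual K) k) t) ->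
  measurable_fun setT (fun t => h (noise (iota k) t) t) ->
  (\int[P]_t (h ((eps t : dual K) k) t)%:E =
   \int[P]_t (h (noise (iota k) t) t)%:E)%E.
Proof.
move=> m1 m2; have [_ _ en] := eps_vec.
apply: ae_eq_integral => //; [exact/measurable_EFinP|exact/measurable_EFinP|].
by apply: filterS (en k) => t /= h1 _; rewrite h1.
Qed.

Lemma eps_sq (k : K) :
  (\int[P]_t (((eps t : dual K) k : R) ^+ 2)%:E = (inner (Seps (iota k)) (iota k))%:E)%E.
Proof.
rewrite (@eps_noise_integral k (fun r _ => r ^+ 2)).
- have [_ _ <-] := noise_cov; rewrite expectationE.
  by apply: eq_integral => t _; rewrite expr2.
- by apply: measurable_funX; exact: measurable_eps.
- by apply: measurable_funX; exact: measurable_funPT.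
Qed.

Lemma eps_finite_variance (k : K) :
  finite_variance P (fun t => (eps t : dual K) k : R).
Proof. by split; [exact: measurable_eps|rewrite eps_sq ltry]. Qed.

Lemma eps_mean (k : K) : (\int[P]_t ((eps t : dual K) k)%:E = 0)%E.
Proof. by have [_ em _] := eps_vec; rewrite -expectationE em. Qed.

Lemma centred_eps_uncorrelated (v : X) (k : K) :
  (\int[P]_t (inner ((x t : X) - mu) v * (eps t : dual K) k)%:E = 0)%E.
Proof.
have mn : measurable_fun setT (noise (iota k)) by exact: measurable_funPT.
rewrite (@eps_noise_integral k (fun r t => inner ((x t : X) - mu) v * r));
  [|by apply: measurable_funM => //; [exact: measurable_centred|exact: measurable_eps]
   |by apply: measurable_funM => //; exact: measurable_centred].
have vn : finite_variance P (noise (iota k)).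
  split=> //; have [_ _ nc] := noise_cov.
  under eq_integral do rewrite expr2.
  by rewrite -expectationE nc ltry.
apply: independent_integralM0 => //.
- exact: measurable_centred.
- move=> B C mB mC; apply: indep.
    exists ((fun u : X => inner (u - mu) v) @^-1` B); last by rewrite setTI.
    have m : measurable_fun [set: borel X] (fun u : borel X => inner ((u : X) - mu) v).
      under eq_fun do rewrite innerBl.
      by apply: measurable_funB => //; exact: inner_borel_measurable.
    by have := m measurableT B mB; rewrite setTI.
  apply: sub_sigma_algebra; exists (iota k) => //; exists C => //.
  by rewrite setTI.
- exact: finite_variance_integrableM (centred_finite_variance v) vn.
- exact: finite_variance_integrable.
- by have [_ n0 _] := noise_cov; rewrite -expectationE.
Qed.

Let y : T -> dual K := fun t => adjoint_to_dual iota (A (x t : X)) + (eps t : dual K).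

Let rho : set (borel X * borel (dual K)) -> \bar R :=
  pushforward P (fun t => (x t, y t) : borel X * borel (dual K)).

(** Needed to pull integrals against [rho] back to [P]. For the second component, evaluations
    suffice because [K] is separable. *)
Lemma measurable_data : measurable_fun setT
  (fun t => (x t, y t) : borel X * borel (dual K)).
Proof.
apply: measurable_fun_pair; first exact: measurable_funPT.
apply: (measurable_into_dual sepK) => v; rewrite /y.
rewrite (_ : (fun t => _) = (fun t =>
    inner (x t : X) (adjoint A (iota v)) + (eps t : dual K) v)); last first.
  apply/funext => t; rewrite dualDE adjoint_to_dualE// innerC -adjointP//.
  by rewrite innerC.
by apply: measurable_funD; [exact: measurable_inner_x|exact: measurable_eps].
Qed.

Definition risk_coord (h : X) (B : X -> X) (e : X) : R :=
  let k := gain_coef A Seps iota B e in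
  let a := adjoint A (iota k) - e in
  inner (Sx a) a + inner (Seps (iota k)) (iota k) + inner (mu - h) a ^+ 2.

Lemma risk_coord_ge0 h B e : 0 <= risk_coord h B e.
Proof.
by rewrite !addr_ge0// ?covariance_ge0 ?noise_covariance_ge0// sqr_ge0.
Qed.

Variable g : nat -> X.
Hypothesis gB : padded_basis g.

Lemma risk_series h B : admissible A Seps iota B ->
  risk A Seps iota rho h B = (\sum_(n <oo) (risk_coord h B (g n))%:E)%E.
Proof.
move=> aB.
pose k n := gain_coef A Seps iota B (g n).
pose c n (z : borel X * borel (dual K)) : R :=
  inner h (g n) + (((z.2 : dual K) (k n) : R) - inner (A h) (iota (k n))) - inner (z.1 : X) (g n).
have cE n z : inner (recon A Seps iota h B z.2 - (z.1 : X)) (g n) = c n z.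
  rewrite reconE// innerBl innerDl.
  rewrite (gainE bA bSeps Seps_inj noise_covariance_sym noise_covariance_ge0 biota
    iota_inj aB).
  by rewrite dualBE adjoint_to_dualE.
have mc n : measurable_fun setT (c n).
  apply: measurable_funB; last first.
    exact: (measurableT_comp (inner_borel_measurable _) measurable_fst).
  apply: measurable_funD => //; apply: measurable_funB => //.
  exact: (measurableT_comp (dual_eval_borel_measurable _) measurable_snd).
have mc2 n : measurable_fun setT (fun z => (c n z ^+ 2)%:E).
  by apply/measurable_EFinP; exact: measurable_funX.
have -> : risk A Seps iota rho h B =
    (\int[rho]_z \sum_(n <oo) (c n z ^+ 2)%:E)%E.
  rewrite /risk; congr integral; apply/funext => z.
  by rewrite (parseval gB); apply: eq_eseriesr => n _; rewrite cE.
rewrite /rho ge0_integral_pushforward//; first last.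
- by move=> z _; apply: nneseries_ge0 => n _ _; rewrite lee_fin sqr_ge0.
- apply: (@ge0_emeasurable_sum _ _ _ _ _ xpredT) => // n z _ _.
  by rewrite lee_fin sqr_ge0.
- exact: measurable_data.
rewrite preimage_setT integral_nneseries//; first last.
- by move=> n t _ /=; rewrite lee_fin sqr_ge0.
- by move=> n; exact: (measurableT_comp (mc2 n) measurable_data).
apply: eq_eseriesr => n _.
(* Substitute the data and centre [x] at [mu]: the summands are centred signal, deterministic bias
   and noise, and all cross terms integrate to 0. *)
transitivity (\int[P]_t ((inner ((x t : X) - mu) (adjoint A (iota (k n)) - g n) +
   inner (mu - h) (adjoint A (iota (k n)) - g n) + (eps t : dual K) (k n)) ^+ 2)%:E)%E.
  apply: eq_integral => t _; rewrite /= /c /y /=; congr ((_ ^+ 2)%:E).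
  rewrite [X in _ + (X - _) - _](_ : _ = inner (A (x t : X)) (iota (k n)) +
    (eps t : dual K) (k n)); last by rewrite -(adjoint_to_dualE biota).
  rewrite !innerBr !innerBl.
  by rewrite !(innerC _ (adjoint _ _)) !adjointP// !(innerC (iota _)); ring.
rewrite integral_sqrD3 ?centred_sq ?eps_sq//.
- exact: centred_finite_variance.
- exact: eps_finite_variance.
- exact: centred_mean.
- exact: eps_mean.
- exact: centred_eps_uncorrelated.
Qed.

End risk_formula.

(** * Minimisers *)


Section quadratic_identity.
Context (R : realType) (X Y K : hilbertType R).
Variables (A : X -> Y) (iota : K -> Y) (Sx : X -> X) (Seps : Y -> Y).
Hypothesis bA : bounded_op A.
Hypothesis bSx : bounded_op Sx.
Hypothesis sSx : forall u v, inner (Sx u) v = inner u (Sx v).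
Hypothesis bSeps : bounded_op Seps.
Hypothesis sSeps : forall u v, inner (Seps u) v = inner u (Seps v).
Hypothesis biota : bounded_op iota.

(* Completing the square around a solution [k] of the normal equation. *)
Lemma quadratic_excess (e : X) (k d : K) :
  A (Sx (adjoint A (iota k))) + Seps (iota k) = A (Sx e) ->
  inner (Sx (adjoint A (iota (k + d)) - e)) (adjoint A (iota (k + d)) - e) +
    inner (Seps (iota (k + d))) (iota (k + d)) =
  inner (Sx (adjoint A (iota k) - e)) (adjoint A (iota k) - e) +
    inner (Seps (iota k)) (iota k) +
  (inner (Sx (adjoint A (iota d))) (adjoint A (iota d)) +
    inner (Seps (iota d)) (iota d)).
Proof.
move=> ke; have bA' := adjoint_bounded bA.
set p := adjoint A (iota d); set a := adjoint A (iota k) - e.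
have -> : adjoint A (iota (k + d)) - e = a + p.
  by rewrite (boundedD biota) (boundedD bA') addrAC.
have cross : inner (Sx a) p + inner (Seps (iota k)) (iota d) = 0.
  rewrite /p innerC adjointP// innerC -innerDl /a (boundedB bSx) (boundedB bA).
  by rewrite addrAC ke subrr inner0l.
clearbody p a.
rewrite (boundedD biota) (boundedD bSx) (boundedD bSeps) !innerDl !innerDr.
rewrite (sSx p a) (innerC p) (sSeps (iota d)) (innerC (iota d)); lra.
Qed.

End quadratic_identity.

Lemma nneseries_eq0_term (R : realType) (f : nat -> R) : (forall n, 0 <= f n) ->
  (\sum_(n <oo) (f n)%:E <= 0)%E -> forall n, f n = 0.
Proof.
move=> f0 s0 n; apply/eqP; rewrite eq_le f0 andbT -lee_fin.
apply: le_trans s0; rewrite (nneseriesD1 (n := n))//; last first.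
  by move=> k _; rewrite lee_fin.
by rewrite leeDl// nneseries_ge0// => k _ _; rewrite lee_fin.
Qed.

Lemma dense_range_orthogonal (R : realType) (K Y : hilbertType R) (T : K -> Y) u :
  dense (range T) -> (forall k, inner u (T k) = 0) -> u = 0.
Proof.
move=> dT uT; apply/eqP; rewrite -normr_eq0; apply/negPn/negP => u0.
have up : 0 < `|u| by rewrite lt_neqAle eq_sym u0 normr_ge0.
have [_ [k _ <-] h] := dense_approx dT u up.
have : `|u| ^+ 2 <= `|u| * `|u - T k|.
  apply: le_trans (inner_CauchySchwarz _ _).
  by rewrite innerBr uT subr0 sqr_norm ler_norm.
by rewrite expr2 ler_pM2l// leNgt h.
Qed.

Section minimizers.
Context (R : realType) (X Y K : hilbertType R).
Context (A : X -> Y) (iota : K -> Y) (mu : X) (Sx : X -> X) (Seps : Y -> Y).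
Context (d : measure_display) (T : measurableType d) (P : probability T R).
Context (x : {RV P >-> borel X}) (noise : Y -> {RV P >-> R}).
Context (eps : {RV P >-> borel (dual K)}).
Hypothesis sepK : separable K.
Hypothesis bA : bounded_op A.
Hypothesis x_sq : square_integrable P (x : T -> X).
Hypothesis x_mean : is_mean P x mu.
Hypothesis x_cov : is_covariance P x mu Sx.
Hypothesis Sx_trace : trace_class Sx.
Hypothesis noise_cov : zero_mean_linear_process noise Seps.
Hypothesis bSeps : bounded_op Seps.
Hypothesis Seps_inj : injective Seps.
Hypothesis indep : independent_sigma P (sigma_rv x) (sigma_process noise).
Hypothesis biota : bounded_op iota.
Hypothesis iota_inj : injective iota.
Hypothesis iota_dense : dense (range iota).
Hypothesis eps_vec : noise_vector iota noise (eps : T -> dual K).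
Hypothesis Sx_adm : admissible A Seps iota (sqrt_op Sx).

Local Notation S := (sqrt_op Sx).
Local Notation W := (gain A Seps iota).
Local Notation k := (gain_coef A Seps iota).

Let y : T -> dual K := fun t => adjoint_to_dual iota (A (x t : X)) + (eps t : dual K).
Let rho : set (borel X * borel (dual K)) -> \bar R :=
  pushforward P (fun t => (x t, y t) : borel X * borel (dual K)).

Let bSx : bounded_op Sx. Proof. by case: Sx_trace. Qed.
Let sSx := covariance_sym x_cov.
Let pSx := covariance_ge0 x_cov.
Let sSeps := noise_covariance_sym noise_cov.
Let pSeps := noise_covariance_ge0 noise_cov.
Let SxP : positive_op Sx. Proof. by split. Qed.

Let SS u : S (S u) = Sx u.
Proof. by have [_ /(congr1 (fun f => f u))] := sqrt_opP SxP. Qed.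

Let bA' := adjoint_bounded bA.

Lemma gain_coef_eq_gain B : admissible A Seps iota B ->
  W B =1 W S -> forall e, k B e = k S e.
Proof.
move=> aB WW e; apply: inner_ext => u; rewrite innerC [RHS]innerC.
rewrite -!riesz_mapE.
rewrite -(gainE bA bSeps Seps_inj sSeps pSeps biota iota_inj aB).
by rewrite -(gainE bA bSeps Seps_inj sSeps pSeps biota iota_inj Sx_adm) WW.
Qed.

(** The first two terms are the quadratic gap between the coefficients. The bias term is kept whole,
    since it is zero at the reference pair [(mu, S)]. *)
Definition risk_excess (h : X) (B : X -> X) (e : X) : R :=
  let dk := k B e - k S e in
  inner (Sx (adjoint A (iota dk))) (adjoint A (iota dk)) +
  inner (Seps (iota dk)) (iota dk) +
  inner (mu - h) (adjoint A (iota (k B e)) - e) ^+ 2.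

Lemma risk_excess_ge0 h B e : 0 <= risk_excess h B e.
Proof. by rewrite !addr_ge0// sqr_ge0. Qed.

Lemma normal_equation e :
  A (Sx (adjoint A (iota (k S e)))) + Seps (iota (k S e)) = A (Sx e).
Proof.
rewrite -!SS.
exact: (gain_coefE bA bSeps Seps_inj sSeps pSeps biota iota_inj Sx_adm).
Qed.

Lemma risk_coordE h B e :
  risk_coord A iota mu Sx Seps h B e =
  risk_coord A iota mu Sx Seps mu S e + risk_excess h B e.
Proof.
have := quadratic_excess bA bSx sSx bSeps sSeps biota (k B e - k S e)
  (normal_equation e).
rewrite (addrC (k S e)) subrK /risk_coord /risk_excess subrr inner0l expr0n/=.
by lra.
Qed.

(** The right side is the value at the zero coefficient, reached from the optimal one by the
    displacement [- k S e]. *)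
Lemma risk_coord_le e : risk_coord A iota mu Sx Seps mu S e <= inner (Sx e) e.
Proof.
have := quadratic_excess bA bSx sSx bSeps sSeps biota (- k S e)
  (normal_equation e).
rewrite subrr (bounded0 biota) (bounded0 bA') (bounded0 bSeps) inner0l sub0r.
rewrite (boundedN bSx) innerNl innerNr opprK.
rewrite /risk_coord subrr inner0l expr0n/=.
have := pSx (adjoint A (iota (- k S e))); have := pSeps (iota (- k S e)).
by lra.
Qed.

Variable g : nat -> X.
Hypothesis gB : padded_basis g.

(** By Parseval and exchange of sum and integral, the series is the expectation of [|x - mu|^2], at
    most [2 E|x|^2 + 2 |mu|^2]. *)
Lemma covariance_series_fin : (\sum_(n <oo) (inner (Sx (g n)) (g n))%:E < +oo)%E.
Proof.
under eq_eseriesr => n _ do rewrite -(centred_sq x_cov).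
rewrite -integral_nneseries//; first last.
- by move=> n t _; rewrite lee_fin sqr_ge0.
- move=> n; apply/measurable_EFinP; apply: measurable_funX.
  exact: measurable_centred.
under eq_integral do rewrite -(parseval gB).
have mn : measurable_fun setT (fun t => `|(x t : X)| : R).
  apply: (measurableT_comp _ (measurable_funPT x)).
  by apply: (@continuous_borel_measurable R X (fun u : X => `|u|)) => u; exact: norm_continuous.
apply: (@le_lt_trans _ _ (\int[P]_t (2%:E * (`|(x t : X)| ^+ 2)%:E +
    (2 * `|mu| ^+ 2)%:E))%E).
  apply: ge0_le_integral => //.
  - rewrite (_ : (fun t => _) = (fun t => \sum_(n <oo)
      (inner ((x t : X) - mu) (g n) ^+ 2)%:E)%E); last first.
      by apply/funext => t; exact: parseval.
    apply: (@ge0_emeasurable_sum _ _ _ _ _ xpredT) => [n t _ _|n _].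
      by rewrite lee_fin sqr_ge0.
    apply/measurable_EFinP; apply: measurable_funX; exact: measurable_centred.
  - apply: emeasurable_funD => //; apply/measurable_EFinP.
    by apply: measurable_funM => //; exact: measurable_funX.
  - move=> t _; rewrite -EFinM -EFinD lee_fin.
    have : `|(x t : X) - mu| ^+ 2 <= (`|(x t : X)| + `|mu|) ^+ 2.
      by rewrite ler_pXn2r ?nnegrE ?addr_ge0// ler_normB.
    by have := sqr_ge0 (`|(x t : X)| - `|mu|); lra.
have vx : finite_variance P (fun t => `|(x t : X)| : R).
  by split=> //; move: x_sq; rewrite /square_integrable expectationE.
have Ix : P.-integrable setT (fun t => (`|(x t : X)| ^+ 2)%:E).
  have := finite_variance_integrableM vx vx.
  by under eq_fun do rewrite -expr2.
have Ic := finite_variance_integrable (finite_variance_cst P (2 * `|mu| ^+ 2)).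
have := integrableD measurableT (integrableZl measurableT 2 Ix) Ic.
move/integrableP => [_]; apply: le_lt_trans.
rewrite le_eqVlt; apply/orP; left; apply/eqP; apply: eq_integral => t _.
by rewrite gee0_abs// -EFinM -EFinD lee_fin addr_ge0// mulr_ge0// ?sqr_ge0.
Qed.

Let riskE h B (aB : admissible A Seps iota B) :=
  risk_series sepK bA x_mean x_cov noise_cov bSeps Seps_inj indep biota iota_inj
    eps_vec gB h aB.

Let rc_ge0 h B e : 0 <= risk_coord A iota mu Sx Seps h B e.
Proof. exact: (risk_coord_ge0 A iota x_cov noise_cov). Qed.

Lemma risk_decomposition h B : admissible A Seps iota B ->
  risk A Seps iota rho h B =
  (risk A Seps iota rho mu S + \sum_(n <oo) (risk_excess h B (g n))%:E)%E.
Proof.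
move=> aB.
rewrite (riskE h aB) (riskE mu Sx_adm) -nneseriesD.
- by apply: eq_eseriesr => n _; rewrite -EFinD -risk_coordE.
- by move=> n _ _; rewrite lee_fin rc_ge0.
- by move=> n _ _; rewrite lee_fin risk_excess_ge0.
Qed.

(** Allows the optimal risk to be cancelled in [\bar R], so that a minimiser has total excess at
    most 0. *)
Lemma optimal_risk_fin : risk A Seps iota rho mu S \is a fin_num.
Proof.
rewrite (riskE mu Sx_adm) ge0_fin_numE; last first.
  by apply: nneseries_ge0 => n _ _; rewrite lee_fin rc_ge0.
apply: le_lt_trans covariance_series_fin; apply: lee_nneseries => n _.
  by move=> _; rewrite lee_fin rc_ge0.
by rewrite lee_fin risk_coord_le.
Qed.

Lemma sqrt_is_minimizer : is_minimizer A Seps iota rho mu S.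
Proof.
split=> // h B aB; rewrite (risk_decomposition h aB) leeDl//.
by apply: nneseries_ge0 => n _ _; rewrite lee_fin risk_excess_ge0.
Qed.

(** Every excess term vanishes on the basis. Strict positivity of [Seps] and injectivity of [iota]
    give equal coefficients; the bias terms say that [(I - W iota^* A) (mu - h)] is orthogonal to
    the basis, hence zero, and injectivity gives [h = mu]. *)
Lemma minimizer_gain h B : is_minimizer A Seps iota rho h B ->
  h = mu /\ W B =1 W S.
Proof.
move=> [aB mB].
have ex0 n : risk_excess h B (g n) = 0.
  apply: (@nneseries_eq0_term _ (fun n => risk_excess h B (g n))) => [m|]; first exact: risk_excess_ge0.
  have := mB mu S Sx_adm; rewrite (risk_decomposition h aB).
  by rewrite -{2}(adde0 (risk A Seps iota rho mu S)) leeD2lE// optimal_risk_fin.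
have kk n : k B (g n) = k S (g n).
  have := ex0 n; rewrite /risk_excess; set dk := k B _ - k S _ => e0.
  have : inner (Seps (iota dk)) (iota dk) = 0.
    have := pSeps (iota dk); have := pSx (adjoint A (iota dk)).
    by have := sqr_ge0 (inner (mu - h) (adjoint A (iota (k B (g n))) - g n)); lra.
  move=> /(Seps_form_eq0 bSeps Seps_inj sSeps pSeps); rewrite -(bounded0 biota).
  by move=> /iota_inj/eqP; rewrite subr_eq0 => /eqP.
have [_ _ tg] := gB.
split.
  apply/esym/eqP; rewrite -subr_eq0; apply/eqP.
  apply: (gain_data_inj bA bSeps Seps_inj sSeps pSeps biota iota_inj aB).
  apply: tg => n.
  rewrite (gain_data_inner bA bSeps Seps_inj sSeps pSeps biota iota_inj aB).
  have := ex0 n; rewrite /risk_excess; set dk := k B _ - k S _.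
  set c := inner (mu - h) _ => e0.
  have c0 : c ^+ 2 = 0.
    have := pSeps (iota dk); have := pSx (adjoint A (iota dk)).
    by have := sqr_ge0 c; lra.
  move/eqP: c0; rewrite sqrf_eq0 => /eqP c0.
  by rewrite -[X in inner _ X]opprB innerNr -/c c0 oppr0.
move=> f; apply/eqP; rewrite -subr_eq0; apply/eqP; apply: tg => n.
rewrite innerBl (gainE bA bSeps Seps_inj sSeps pSeps biota iota_inj aB).
by rewrite (gainE bA bSeps Seps_inj sSeps pSeps biota iota_inj Sx_adm) kk subrr.
Qed.

Lemma minimizerP h B : admissible A Seps iota B ->
  is_minimizer A Seps iota rho h B <->
  h = mu /\ forall u, orthocomp (A @^-1` [set 0]) u -> B (B u) = Sx u.
Proof.
move=> aB; split=> [mB|[-> BB]].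
  have [hmu WW] := minimizer_gain mB; split=> // u uo; rewrite -SS.
  apply: (gain_coef_prior_eq bA bSeps Seps_inj sSeps pSeps biota iota_inj
    aB Sx_adm _ uo).
  exact: gain_coef_eq_gain.
have kk := prior_eq_gain_coef bA bSeps Seps_inj sSeps pSeps biota iota_inj aB
  Sx_adm (fun u uo => etrans (BB u uo) (esym (SS u))).
split=> // h' B' aB'; apply: le_trans (sqrt_is_minimizer.2 h' B' aB').
rewrite (risk_decomposition mu aB) eseries0 ?adde0// => n _ _.
rewrite /risk_excess kk !subrr (bounded0 biota) (bounded0 bA') (bounded0 bSeps).
by rewrite (bounded0 bSx) !inner0l expr0n !addr0.
Qed.

Lemma minimizer_unique h B : injective A -> is_minimizer A Seps iota rho h B ->
  h = mu /\ B = S.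
Proof.
move=> iA mB; have [pB _] := mB.1; have [pS _] := Sx_adm.
have [hmu BB] := (minimizerP h mB.1).1 mB; split=> //.
apply: positive_sqrt_unique => //; apply/funext => u /=; rewrite SS.
apply: BB => v /= Av; rewrite (iA v 0) ?inner0r//.
by rewrite Av (bounded0 bA).
Qed.

Lemma minimizer_recon h B : is_minimizer A Seps iota rho h B -> forall z,
  recon A Seps iota h B z = mu + W S (z - adjoint_to_dual iota (A mu)).
Proof.
move=> mB z; have [-> WW] := minimizer_gain mB.
by rewrite reconE ?WW//; exact: mB.1.
Qed.

(** * The closed form through the data covariance *)

Let Sy w := A (Sx (adjoint A w)) + Seps w.

Let Sy_inj w : Sy w = 0 -> w = 0.
Proof.
move=> Sw; apply: (Seps_form_eq0 bSeps Seps_inj sSeps pSeps).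
have : inner (Sy w) w = 0 by rewrite Sw inner0l.
rewrite /Sy innerDl innerC -adjointP// innerC.
by have := pSx (adjoint A w); have := pSeps w; lra.
Qed.

Let bSy : bounded_op Sy.
Proof. exact: (bounded_add (bounded_comp bA (bounded_comp bSx bA')) bSeps). Qed.

Let sSy u v : inner (Sy u) v = inner u (Sy v).
Proof.
rewrite /Sy innerDl innerDr sSeps; congr (_ + _).
by rewrite innerC -adjointP// -sSx innerC adjointP.
Qed.

Lemma data_covE w l : data_cov A Seps iota Sx w l = inner (Sy w) (iota l).
Proof. by rewrite /data_cov /= adjoint_to_dualE. Qed.

(** [Sy] is strictly positive, and [iota^*] loses nothing because [iota] has dense range. *)
Lemma data_cov_inj : injective (data_cov A Seps iota Sx).
Proof.
move=> u v uv; apply/eqP; rewrite -subr_eq0; apply/eqP/Sy_inj.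
apply: (dense_range_orthogonal iota_dense) => l.
by rewrite (boundedB bSy) innerBl -!data_covE uv subrr.
Qed.

(** Paired with [e], the image of [data_cov w] is [<Sy w, iota k_e> = <w, Sy (iota k_e)>], and the
    normal equation turns it into [<w, A Sx e> = <Sx A^* w, e>]. *)
Lemma gain_bounded_extension : bounded_extension A Seps iota Sx (W S).
Proof.
split; first exact: (gain_bounded bA bSeps Seps_inj sSeps pSeps biota iota_inj Sx_adm).
move=> _ [w _ <-]; rewrite inv_opK; last exact: data_cov_inj.
apply: inner_ext => e.
rewrite (gainE bA bSeps Seps_inj sSeps pSeps biota iota_inj Sx_adm) data_covE.
by rewrite sSy /Sy normal_equation sSx adjointP.
Qed.

(* The range of [data_cov] is dense in [K^*]: through the Riesz map, a functional
   vanishing on it is represented by some [m] with [Sy (iota m) = 0]. *)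
Lemma bounded_extension_unique L1 L2 :
  bounded_extension A Seps iota Sx L1 -> bounded_extension A Seps iota Sx L2 ->
  L1 = L2.
Proof.
move=> [b1 e1] [b2 e2]; apply/funext => f; apply: inner_ext => v.
have bJ := adjoint_to_dual_bounded (@bounded_id _ K).
pose D u := L1 (riesz_map u) + (-1) *: L2 (riesz_map u).
have bD : bounded_op D.
  exact: (bounded_add (bounded_comp b1 bJ) (bounded_scale _ (bounded_comp b2 bJ))).
have [u uf] := riesz_map_surj f.
have m0 : adjoint D v = 0.
  apply: iota_inj; rewrite (bounded0 biota); apply: Sy_inj.
  apply: inner_ext => w; rewrite inner0l sSy innerC.
  have [l lw] := riesz_map_surj (data_cov A Seps iota Sx w).
  rewrite -data_covE -lw riesz_mapE innerC adjointP// /D lw.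
  have rw : range (data_cov A Seps iota Sx) (data_cov A Seps iota Sx w) by exists w.
  by rewrite e1// e2// scaleN1r subrr inner0r.
have : inner (D u) v = 0 by rewrite innerC -adjointP// m0 inner0l.
rewrite /D uf scaleN1r innerBl => /eqP; rewrite subr_eq0 => /eqP; exact.
Qed.

End minimizers.

Theorem theorem3p1 (R : realType) (X Y K : hilbertType R)
  (A : X -> Y) (iota : K -> Y) (mu : X) (Sx : X -> X) (Seps : Y -> Y)
  (d : measure_display) (T : measurableType d) (P : probability T R)
  (x : {RV P >-> borel X}) (noise : Y -> {RV P >-> R})
  (eps : {RV P >-> borel (dual K)})
  (sepX : separable X) (sepY : separable Y) (sepK : separable K)
  (bA : bounded_op A)
  (x_sq : square_integrable P (x : T -> X))
  (x_mean : is_mean P x mu)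
  (x_cov : is_covariance P x mu Sx)
  (Sx_trace : trace_class Sx) (Sx_inj : injective Sx)
  (noise_cov : zero_mean_linear_process noise Seps)
  (bSeps : bounded_op Seps) (Seps_inj : injective Seps)
  (indep : independent_sigma P (sigma_rv x) (sigma_process noise))
  (biota : bounded_op iota) (iota_inj : injective iota)
  (iota_dense : dense (range iota))
  (iota_trace : trace_class_to_dual (adjoint_to_dual iota \o Seps \o iota))
  (eps_vec : noise_vector iota noise (eps : T -> dual K))
  (Sx_adm : admissible A Seps iota (sqrt_op Sx)) :
  let y : T -> dual K := fun t => adjoint_to_dual iota (A (x t)) + eps t in
  let rho : set (borel X * borel (dual K)) -> \bar R :=
    pushforward P (fun t => (x t, y t) : borel X * borel (dual K)) in
  let kerA := A @^-1` [set 0] in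
  [/\ (forall h B, admissible A Seps iota B ->
        is_minimizer A Seps iota rho h B <->
        h = mu /\ forall u, orthocomp kerA u -> B (B u) = Sx u),
      is_minimizer A Seps iota rho mu (sqrt_op Sx),
      (injective A -> forall h B, is_minimizer A Seps iota rho h B ->
        h = mu /\ B = sqrt_op Sx),
      (forall h B, is_minimizer A Seps iota rho h B -> forall z,
        recon A Seps iota h B z = recon A Seps iota mu (sqrt_op Sx) z) &
      [/\ injective (data_cov A Seps iota Sx),
          (exists! L, bounded_extension A Seps iota Sx L) &
          forall L, bounded_extension A Seps iota Sx L ->
          forall h B, is_minimizer A Seps iota rho h B -> forall z,
            recon A Seps iota h B z =
              mu + L (z - adjoint_to_dual iota (A mu))]].
Proof.
move=> y rho kerA.
have [_ [E hE _]] := Sx_trace.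
(* The orthonormal basis carried by [trace_class] is the one along which the risk is expanded. *)
have [g gB] := separable_padded_basis sepX hE.
have reconW := minimizer_recon sepK bA x_sq x_mean x_cov Sx_trace noise_cov bSeps
  Seps_inj indep biota iota_inj eps_vec Sx_adm gB.
have extW := gain_bounded_extension bA x_cov Sx_trace noise_cov bSeps Seps_inj
  biota iota_inj iota_dense Sx_adm.
have extU := bounded_extension_unique bA x_cov noise_cov bSeps Seps_inj biota
  iota_inj.
split.
- exact: (minimizerP sepK bA x_sq x_mean x_cov Sx_trace noise_cov bSeps Seps_inj
    indep biota iota_inj eps_vec Sx_adm gB).
- exact: (sqrt_is_minimizer sepK bA x_mean x_cov Sx_trace noise_cov bSeps Seps_inj
    indep biota iota_inj eps_vec Sx_adm gB).
- move=> iA h B; exact: (minimizer_unique sepK bA x_sq x_mean x_cov Sx_trace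
    noise_cov bSeps Seps_inj indep biota iota_inj eps_vec Sx_adm gB iA).
- by move=> h B mB z; rewrite (reconW _ _ mB) reconE.
- split.
  + exact: (data_cov_inj bA x_cov Sx_trace noise_cov bSeps Seps_inj biota iota_dense).
  + by exists (gain A Seps iota (sqrt_op Sx)); split=> // L extL; exact: extU.
  + by move=> L extL h B mB z; rewrite (reconW _ _ mB) (extU _ _ extL extW).
Qed.
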